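(* Let $r\geqslant3$ and let $\widehat{\mathcal L}$ be the class of $r$th order linear homogeneous ODEs $x^{(r)}+a_{r-1}(t)x^{(r-1)}+\dots+a_1(t)x^{(1)}+a_0(t)x=0$ with arbitrary smooth functions $a_{r-1},\dots,a_0$ of $t$. Given any equation $\mathcal E$ from $\widehat{\mathcal L}$, a point transformation maps $\mathcal E$ to another equation from the same class if and only if this transformation has the form $$\tilde t=T(t),\quad \tilde x=X_1(t)x+X_0(t),$$ where $T$, $X_1$ and $X_0$ are smooth functions of $t$ with $T_tX_1\ne0$ and the ratio $X_0/X_1$ is a solution of $\mathcal E$.
   Context: The underlying field $\mathbb F$ is $\mathbb R$ or $\mathbb C$; all variables and functions are real or complex, respectively. $x=x(t)$ is the unknown function, $x^{(k)}=d^kx/dt^k$; $T_t$ is the derivative of $T$. Everything is local: functions and transformations are smooth and considered on suitable open domains. A point transformation is a transformation $\tilde t=T(t,x)$, $\tilde x=X(t,x)$ with nonvanishing Jacobian $\partial(T,X)/\partial(t,x)$; it acts on ODEs via prolongation to derivatives. ''Another equation'' is not required to differ from $\mathcal E$. *)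

(* Defs.v *)
From HB Require Import structures.
From mathcomp Require Import all_boot all_order all_algebra.
From mathcomp Require Import complex.
From mathcomp Require Import boolp classical_sets reals topology normedtype.
From mathcomp Require Import derive.

Set Implicit Arguments.
Unset Strict Implicit.
Unset Printing Implicit Defensive.

Import Order.TTheory GRing.Theory Num.Theory.
Import numFieldNormedType.Exports.

Local Open Scope classical_set_scope.
Local Open Scope ring_scope.

(* When F is the field of complex numbers, derivatives are complex ones, so
   that smooth functions are the holomorphic ones. *)

Definition smooth_on (F : numFieldType) (I : set F) (f : F -> F) : Prop :=
  forall n t, I t -> derivable (derive1n n f) t 1.

Definition partial_t (F : numFieldType) (f : F -> F -> F) : F -> F -> F :=
  fun t x => derive1 (f ^~ x) t.

Definition partial_x (F : numFieldType) (f : F -> F -> F) : F -> F -> F :=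
  fun t x => derive1 (f t) x.

Fixpoint Cn_on (F : numFieldType) (n : nat) (U : set (F * F))
    (f : F -> F -> F) : Prop :=
  (forall p, U p -> {for p, continuous (fun q : F * F => f q.1 q.2)}) /\
  (if n is m.+1 then
     [/\ forall p, U p -> derivable (f ^~ p.2) p.1 1,
         forall p, U p -> derivable (f p.1) p.2 1,
         Cn_on m U (partial_t f) & Cn_on m U (partial_x f)]
   else True).

Definition smooth2_on (F : numFieldType) (U : set (F * F))
    (f : F -> F -> F) : Prop :=
  forall n, Cn_on n U f.

Definition point_transformation (F : numFieldType) (U : set (F * F))
    (T X : F -> F -> F) : Prop :=
  [/\ open U, smooth2_on U T, smooth2_on U X
    & forall p, U p ->
        partial_t T p.1 p.2 * partial_x X p.1 p.2
        - partial_x T p.1 p.2 * partial_t X p.1 p.2 != 0].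

(* A jet of x(t) at t is encoded by t and the sequence j : nat -> F with j k
   standing for x^(k); a differential function of order at most n depends on t
   and on j 0, ..., j n only, and its total derivative is
   D_t G = G_t + \sum_(k <= n) x^(k+1) G_{x^(k)}. *)
Definition total_derivative (F : numFieldType) (n : nat)
    (G : F -> (nat -> F) -> F) : F -> (nat -> F) -> F :=
  fun t j => derive1 (G ^~ j) t +
    \sum_(k < n.+1)
      j k.+1 * derive1 (fun s => G t [eta j with (k : nat) |-> s]) (j k).

Definition on_jets (F : numFieldType) (f : F -> F -> F) :
    F -> (nat -> F) -> F :=
  fun t j => f t (j 0%N).

(* The expression of the k-th derivative of \tilde x with respect to \tilde t
   in terms of the jet of x, namely ((D_t T)^-1 D_t)^k X; it is meaningful at
   the jets where D_t T does not vanish. *)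
Fixpoint prolongation (F : numFieldType) (T X : F -> F -> F) (k : nat) :
    F -> (nat -> F) -> F :=
  if k is m.+1 then
    fun t j => total_derivative m (prolongation T X m) t j
               / total_derivative 0 (on_jets T) t j
  else on_jets X.

Definition linear_ode_lhs (F : numFieldType) (r : nat) (a : 'I_r -> F -> F)
    (t : F) (j : nat -> F) : F :=
  j r + \sum_(k < r) a k t * j k.

Definition in_linear_class (F : numFieldType) (r : nat) (I : set F)
    (a : 'I_r -> F -> F) : Prop :=
  open I /\ forall k, smooth_on I (a k).

Definition solution_on (F : numFieldType) (r : nat) (I : set F)
    (a : 'I_r -> F -> F) (y : F -> F) : Prop :=
  (forall k t, (k < r)%N -> I t -> derivable (derive1n k y) t 1) /\
  (forall t, I t -> linear_ode_lhs a t (fun k => derive1n k y t) = 0).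

(* Over V, the prolonged transformation maps the equation with coefficients a,
   viewed as a submanifold of the jet space of order r, to the one with
   coefficients b. *)
Definition maps_ode (F : numFieldType) (r : nat) (V : set (F * F))
    (T X : F -> F -> F) (a b : 'I_r -> F -> F) : Prop :=
  forall (t : F) (j : nat -> F), V (t, j 0%N) ->
    total_derivative 0 (on_jets T) t j != 0 ->
    (linear_ode_lhs a t j = 0 <->
     linear_ode_lhs b (T t (j 0%N)) (fun k => prolongation T X k t j) = 0).

(* Main.v *)
(* Necessity: write A_k for the coefficient of x^(k) in the k-th prolonged
   derivative P_k and B_k for the partial derivative of P_(k+1) by x^(k).
   Differentiating the transformed equation by x^(r-1) along the original one
   gives B_(r-1) = a_(r-1) A_r - b_(r-1) A_(r-1). The right-hand side involves
   no jet variable beyond x^(1), while B_(r-1) contains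
   - C(r+1,2) Delta T_x / (D_t T)^(r+2) x^(2), Delta being the Jacobian; since
   r >= 3 this forces T_x = 0. Then D_t T is a function of t alone, the
   right-hand side does not involve x^(1) either, and the coefficient
   r X_xx / T_t^r of x^(1) in B_(r-1) must vanish. Hence T = T(t) and
   X = X1 x + X0 = X1 (x + y), so that P_k is a linear combination of
   x + y and its derivatives; comparing coefficients, y = X0 / X1 satisfies the
   original equation.
   Sufficiency: for T = T(t) the P_k are related to (x + y)^(i) by a triangular
   matrix with smooth entries, which gives the coefficients of the target
   equation as functions of t; they are composed with a local inverse of T.
   The real and the complex case are treated together, using only that F is
   archimedean and that geometrically convergent sequences have limits. *)

Require Import Defs.
From HB Require Import structures.
From mathcomp Require Import all_boot all_order all_algebra.
From mathcomp Require Import complex.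
From mathcomp Require Import boolp classical_sets reals topology normedtype.
From mathcomp Require Import derive.
From mathcomp Require Import ring lra.

Set Implicit Arguments.
Unset Strict Implicit.
Unset Printing Implicit Defensive.

Import Order.TTheory GRing.Theory Num.Theory.
Import numFieldNormedType.Exports.

Local Open Scope classical_set_scope.
Local Open Scope ring_scope.

(** * One-variable calculus over a complete field *)

Lemma halfpowS (F : numFieldType) n : (2 : F) ^- n = 2 * 2 ^- n.+1.
Proof. by rewrite exprS invfM mulrA divff ?pnatr_eq0// mul1r. Qed.

Lemma halfpow_gt0 (F : numFieldType) n : 0 < (2 : F) ^- n.
Proof. by rewrite invr_gt0 exprn_gt0. Qed.

(** The two facts shared by the real and the complex field on which all limit arguments rest. Dyadic
    rates suffice because the bisection and the contraction with factor 1/2 used below converge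
    geometrically. *)
Definition geometrically_complete (F : numFieldType) : Prop :=
  (forall e : F, 0 < e -> exists n : nat, 2 ^- n < e) /\
  (forall (z : nat -> F) (K : F), (forall n, `|z n.+1 - z n| <= K * 2 ^- n) ->
     exists l K' : F, forall n, `|z n - l| <= K' * 2 ^- n).

Lemma geometrically_complete_small (F : numFieldType) (C e : F) :
  geometrically_complete F -> 0 <= C -> 0 < e -> exists n, C * 2 ^- n < e.
Proof.
move=> [archF _] C0 e0; have C1 : 0 < C + 1 by rewrite ltr_wpDl.
have [|n] := archF (e / (C + 1)); first by rewrite divr_gt0.
rewrite ltr_pdivlMr// mulrC => nlt; exists n; apply: le_lt_trans nlt.
by rewrite ler_pM2r ?halfpow_gt0// lerDl.
Qed.

(** With h n = 2 K / 2^n, the sequence z n - h n is nondecreasing and z n + h n is nonincreasing;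
    the supremum of the former lies between both, hence within h n of z n. *)
Lemma geometrically_complete_real (R : realType) :
  geometrically_complete (R : numFieldType).
Proof.
split=> [e e0|z K zK].
  exists (Num.bound e^-1).
  rewrite -[ltRHS]invrK ltf_pV2 ?posrE ?invr_gt0 ?exprn_gt0//.
  exact: upper_nthrootP (leqnn _).
pose h n := 2 * K * 2 ^- n.
have hS n : h n = K * 2 ^- n + h n.+1.
  by rewrite /h (halfpowS R n); ring.
have lo n m : z n - h n <= z (n + m)%N - h (n + m)%N.
  elim: m => [|m]; first by rewrite addn0.
  rewrite addnS; move/le_trans; apply.
  by move: (zK (n + m)%N) (hS (n + m)%N); rewrite ler_norml; lra.
have hi n m : z (n + m)%N + h (n + m)%N <= z n + h n.
  elim: m => [|m]; first by rewrite addn0.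
  rewrite addnS; apply: le_trans.
  by move: (zK (n + m)%N) (hS (n + m)%N); rewrite ler_norml; lra.
have K0 : 0 <= K.
  by have := zK 0%N; rewrite expr0 invr1 mulr1; apply: le_trans.
have h0 n : 0 <= h n by rewrite /h !mulr_ge0// ltW// halfpow_gt0.
have lohi n m : z n - h n <= z m + h m.
  have [nm|/ltnW mn] := leqP n m.
    have := lo n (m - n)%N; rewrite subnKC// => /le_trans; apply.
    by have := h0 m; lra.
  have := hi m (n - m)%N; rewrite subnKC//; apply: le_trans.
  by have := h0 n; lra.
pose S := [set x | exists n, x = z n - h n].
have S0 : S !=set0 by exists (z 0%N - h 0%N), 0%N.
have Sub m : ubound S (z m + h m) by move=> _ [n ->]; exact: lohi.
exists (sup S), (2 * K) => n; rewrite ler_distl; apply/andP; split.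
- by rewrite lerBlDr; apply: ge_sup.
- by rewrite -lerBlDr; apply: ub_le_sup;
    [exists (z 0%N + h 0%N); exact: Sub|exists n].
Qed.

(** The real case applied to real and imaginary parts, whose increments are bounded by the modulus.
    In the order of [R[i]], 0 < e forces e to be real, which reduces the archimedean part to [R]. *)
Lemma geometrically_complete_complex (R : realType) :
  geometrically_complete (R[i] : numFieldType).
Proof.
have [archiR cauchyR] := geometrically_complete_real R.
have ReV n : (2 ^- n : R[i]) = (2 ^- n)%:C%C.
  by rewrite fmorphV rmorphXn/= rmorph_nat.
split=> [[e1 e2]|z [k1 k2] zK].
  rewrite ltcE/= => /andP[/eqP -> /archiR[n ne]].
  by exists n; rewrite ReV -complexr0 ltcE/= eqxx.
have bnd n : `|complex.Re (z n.+1) - complex.Re (z n)| <= k1 * 2 ^- n /\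
             `|complex.Im (z n.+1) - complex.Im (z n)| <= k1 * 2 ^- n.
  have := zK n; rewrite ReV normc_def => /=.
  case: (z n.+1) (z n) => [a1 a2] [b1 b2] /=.
  rewrite lecE/= !mulr0 subr0 => /andP[_]; set A := Num.sqrt _ => Ak.
  by split; apply: le_trans Ak; rewrite -sqrtr_sqr ler_sqrt ?addr_ge0 ?sqr_ge0//
    ?lerDl ?lerDr sqr_ge0.
have [l1 [m1 l1P]] := cauchyR (fun n => complex.Re (z n)) k1 (fun n => (bnd n).1).
have [l2 [m2 l2P]] := cauchyR (fun n => complex.Im (z n)) k1 (fun n => (bnd n).2).
exists (l1 +i* l2)%C, (m1 + m2)%:C%C => n.
move: (lerD (l1P n) (l2P n)); rewrite -mulrDl ReV -rmorphM/=.
case: (z n) => [a b] /=.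
rewrite normc_def/= lecR => h; apply: le_trans h.
move: (a - l1) (b - l2) => u v.
rewrite -[leRHS]ger0_norm ?addr_ge0// -[leRHS]sqrtr_sqr ler_sqrt ?sqr_ge0//.
rewrite sqrrD !real_normK ?num_real//.
by rewrite lerD2r lerDl mulrn_wge0// mulr_ge0.
Qed.

Section OneVariable.
Variable F : numFieldType.
Implicit Types (f g : F -> F) (t x l : F) (I : set F).

Definition is_deriv1 f t l : Prop := derivable f t 1 /\ derive1 f t = l.

Lemma is_deriv1E f t l : is_deriv1 f t l <-> is_derive t (1 : F) f l.
Proof.
by split=> [[df <-]|[df <-]]; [rewrite derive1E; exact: derivableP|rewrite -derive1E].
Qed.

(** Multiplying out the difference quotient removes the division and the punctured neighbourhood, so
    the estimate can be used at z = x as well. *)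
Lemma is_deriv1P f x l : is_deriv1 f x l <->
  forall e, 0 < e -> exists2 d, 0 < d &
    forall z, `|z - x| < d -> `|f z - f x - l * (z - x)| <= e * `|z - x|.
Proof.
have quotE (h : F) : h != 0 ->
    `|l - h^-1 *: (f (h *: 1 + x) - f x)| * `|h| = `|f (h + x) - f x - l * h|.
  move=> h0; rewrite -normrM [h *: 1]mulr1 mulrBl -mulrAC [_^-1 * h]mulVf//.
  by rewrite mul1r distrC.
rewrite is_deriv1E; split=> [[df dfl] e e0|H].
  have /cvgrPdist_le/(_ e e0)/nbhs_ballP[d/= d0 dP] :
    (fun h : F => h^-1 *: (f (h *: 1 + x) - f x)) @ 0^' --> l by rewrite -dfl; exact: df.
  exists d => // z zd.
  have [->|zx] := eqVneq z x; first by rewrite !subrr mulr0 subr0 normr0 mulr0.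
  have zx0 : z - x != 0 by rewrite subr_eq0.
  have := dP (z - x); rewrite /= /ball/= sub0r normrN => /(_ zd zx0).
  by rewrite -(ler_pM2r (_ : 0 < `|z - x|)) ?normr_gt0// quotE// subrK.
suff lP : (fun h : F => h^-1 *: (f (h *: 1 + x) - f x)) @ 0^' --> l.
  by apply: DeriveDef; [apply/cvg_ex; exists l|exact: cvg_lim lP].
apply/cvgrPdist_le => e e0; have [d d0 dP] := H e e0.
apply/nbhs_ballP; exists d => //= h; rewrite /ball/= sub0r normrN => hd h0.
rewrite -(ler_pM2r (_ : 0 < `|h|)) ?normr_gt0// quotE//.
by have := dP (h + x); rewrite addrK; apply.
Qed.

(* Bisection: a violation of the inequality passes to one half of the segment,
   hence to arbitrarily small segments close to a limit point [l], where it
   contradicts the differentiability of [f]. *)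
Lemma mean_value_ineq (FC : geometrically_complete F) f (c r M u v : F) :
  (forall z, `|z - c| < r -> derivable f z 1 /\ `|derive1 f z| <= M) ->
  `|u - c| < r -> `|v - c| < r -> `|f u - f v| <= M * `|u - v|.
Proof.
have [archF cauchyF] := FC; move=> fM uc vc.
have M0 : 0 <= M by apply: le_trans (fM u uc).2.
have Mr (a b : F) : M * `|a - b| \is Num.real by rewrite realM ?ger0_real.
have [//|lt] := real_leP (normr_real (f u - f v)) (Mr u v).
set w := `|u - v| in lt.
have w0 : 0 < w.
  rewrite normr_gt0 subr_eq0; apply: contraTneq lt => ->.
  by rewrite subrr normr0 /w; apply/negP => /(le_lt_trans (mulr_ge0 M0 (normr_ge0 _))); rewrite ltxx.
(* [M'] lies strictly between [M] and the slope of the violating segment; the gap survives all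
   bisections and contradicts differentiability at the limit point. *)
set M' := (M + `|f u - f v| / w) / 2.
have MM' : M < M' by apply: (midf_lt _).1; rewrite ltr_pdivlMr.
have M'lt : M' * w < `|f u - f v|.
  by rewrite -ltr_pdivlMr//; apply: (midf_lt _).2; rewrite ltr_pdivlMr.
have M'r (a b : F) : M' * `|a - b| \is Num.real.
  by rewrite realM ?ger0_real// ltW// (le_lt_trans M0).
(* A smaller closed ball keeps the limit of the bisection points inside the open ball. *)
have [rho [rhor urho vrho]] : exists rho, [/\ rho < r, `|u - c| <= rho & `|v - c| <= rho].
  have [uv|/ltW vu] := real_leP (normr_real (u - c)) (normr_real (v - c)).
    by exists `|v - c|.
  by exists `|u - c|.
pose bad (p : F * F) := M' * `|p.1 - p.2| < `|f p.1 - f p.2|.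
pose step (p : F * F) := let m := (p.1 + p.2) / 2 in
  if bad (p.1, m) then (p.1, m) else (m, p.2).
pose s n := iter n step (u, v).
have two0 : (2 : F) != 0 by rewrite pnatr_eq0.
have midl (a b : F) : a - (a + b) / 2 = (a - b) / 2.
  by field.
have midr (a b : F) : (a + b) / 2 - b = (a - b) / 2.
  by field.
have half (a : F) : `|a / 2| = `|a| / 2 by rewrite normrM normfV (ger0_norm (ler0n _ _)).
have midc (a b : F) : `|a - c| <= rho -> `|b - c| <= rho -> `|(a + b) / 2 - c| <= rho.
  move=> ac bc; have -> : (a + b) / 2 - c = ((a - c) + (b - c)) / 2 by field.
  rewrite half ler_pdivrMr// mulr_natr mulr2n.
  exact: le_trans (ler_normD _ _) (lerD ac bc).
have sP n : [/\ bad (s n), `|(s n).1 - (s n).2| = w * 2 ^- n,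
    `|(s n).1 - c| <= rho & `|(s n).2 - c| <= rho].
  elim: n => [|n [bn wn an bn']]; first by rewrite expr0 invr1 mulr1.
  rewrite /s iterS -/(s n); case: (s n) bn wn an bn' => a b bn wn an bn'.
  rewrite /step /=; case: ifPn => [badl|badr]; split => //=.
  - by rewrite midl half wn exprSr invfM mulrA.
  - exact: midc.
  - move: badr; rewrite /bad/= -real_leNgt// midl half => le.
    rewrite midr half.
    have := ler_normD (f a - f ((a + b) / 2)) (f ((a + b) / 2) - f b).
    rewrite addrA subrK -lerBlDl; apply: lt_le_trans.
    rewrite ltrBrDl; apply: le_lt_trans bn => /=.
    by rewrite (le_trans (lerD le (lexx _)))// -mulrDr -splitr.
  - by rewrite midr half wn exprSr invfM mulrA.
  - exact: midc.
have zK n : `|(s n.+1).1 - (s n).1| <= w * 2 ^- n.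
  rewrite /s iterS -/(s n); have [_ wn _ _] := sP n; case: (s n) wn => a b /= wn.
  rewrite /step/=; case: ifP => _ /=.
    by rewrite subrr normr0 -wn.
  rewrite distrC midl half wn ler_pdivrMr// ler_peMr// ?ler1n//.
  by rewrite mulr_ge0 ?(ltW w0)// ltW// halfpow_gt0.
have [l [K lK]] := cauchyF _ _ zK.
have K0 : 0 <= K by have := lK 0%N; rewrite expr0 invr1 mulr1; apply: le_trans.
have small C e := @geometrically_complete_small F C e FC.
have lc : `|l - c| < r.
  have [n nlt] := small K (r - rho) K0 (etrans (subr_gt0 _ _) rhor).
  have [_ _ sc _] := sP n.
  have := ler_normD (l - (s n).1) ((s n).1 - c); rewrite addrA subrK.
  move/le_lt_trans; apply; rewrite -(subrK rho r); apply: ltr_leD => //.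
  by rewrite distrC; apply: le_lt_trans nlt.
have [dl Ml] := fM l lc.
have C0 : 0 < K + (K + w) by rewrite ltr_wpDl// ltr_wpDl.
(* With this e, the errors of the linear approximation at both endpoints add up to at most (M' - M)
   w / 2^n, the gap available on a segment of length w / 2^n. *)
have e0 : 0 < (M' - M) * w / (K + (K + w)) by rewrite divr_gt0// mulr_gt0// subr_gt0.
have /is_deriv1P/(_ _ e0)[d d0 dP] : is_deriv1 f l (derive1 f l) by [].
have [n nlt] := small _ _ (ltW C0) d0.
have [bn wn _ _] := sP n; have := lK n.
case: (s n) bn wn => p1 p2; rewrite /bad /= => bn wn p1l.
have p2l : `|p2 - l| <= (K + w) * 2 ^- n.
  have := ler_normD (p1 - l) (p2 - p1); rewrite addrC addrA subrK => /le_trans; apply.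
  by rewrite mulrDl distrC [X in X + _]distrC -wn distrC lerD// distrC.
have [p1d p2d] : `|p1 - l| < d /\ `|p2 - l| < d.
  split; [apply: le_lt_trans p1l _|apply: le_lt_trans p2l _];
  apply: le_lt_trans nlt; rewrite ler_pM2r ?halfpow_gt0//.
    by rewrite lerDl addr_ge0// ltW.
  by rewrite lerDr.
move: (dP _ p1d) (dP _ p2d); set e := _ / _ in e0 dP *; set a := derive1 f l in Ml dP *.
move=> e1 e2; exfalso; move: bn; apply/negP; rewrite -real_leNgt//.
have -> : f p1 - f p2 = (f p1 - f l - a * (p1 - l)) - (f p2 - f l - a * (p2 - l))
  + a * (p1 - p2) by ring.
apply: le_trans (ler_normD _ _) _; rewrite normrM.
apply: le_trans (lerD (ler_normB _ _) (ler_wpM2r (normr_ge0 _) Ml)) _.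
rewrite -lerBrDr -mulrBl; apply: le_trans (lerD e1 e2) _; rewrite -mulrDr.
apply: le_trans (ler_wpM2l (ltW e0) (lerD p1l p2l)) _.
by rewrite -mulrDl mulrA divfK ?gt_eqF// -mulrA -wn.
Qed.
End OneVariable.

(** * Differentiation rules and smooth functions of one variable *)

Section Derivatives.
Variable F : numFieldType.
Implicit Types (f g : F -> F) (t c r l : F) (I J : set F).

Lemma derive1_val f t l : is_deriv1 f t l -> derive1 f t = l.
Proof. by case. Qed.

Lemma is_deriv1_derivable f t l : is_deriv1 f t l -> derivable f t 1.
Proof. by case. Qed.

Lemma derivable_is_deriv1 f t : derivable f t 1 -> is_deriv1 f t (derive1 f t).
Proof. by []. Qed.

Lemma is_deriv1_cst (a : F) t : is_deriv1 (fun=> a) t 0.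
Proof. by apply/is_deriv1E; exact: is_derive_cst. Qed.

Lemma is_deriv1_id t : is_deriv1 id t 1.
Proof. by apply/is_deriv1E; exact: is_derive_id. Qed.

Lemma is_deriv1D f g t df dg : is_deriv1 f t df -> is_deriv1 g t dg ->
  is_deriv1 (fun s => f s + g s) t (df + dg).
Proof.
by move=> /is_deriv1E hf /is_deriv1E hg; apply/is_deriv1E; exact: is_deriveD.
Qed.

Lemma is_deriv1M f g t df dg : is_deriv1 f t df -> is_deriv1 g t dg ->
  is_deriv1 (fun s => f s * g s) t (df * g t + f t * dg).
Proof.
move=> /is_deriv1E hf /is_deriv1E hg; apply/is_deriv1E.
apply: is_derive_eq (is_deriveM hf hg) _.
by rewrite addrC /GRing.scale/= [g t * _]mulrC.
Qed.

Lemma is_deriv1N f t df : is_deriv1 f t df -> is_deriv1 (fun s => - f s) t (- df).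
Proof. by move=> /is_deriv1E hf; apply/is_deriv1E; exact: is_deriveN. Qed.

Lemma is_deriv1V f t df : f t != 0 -> is_deriv1 f t df ->
  is_deriv1 (fun s => (f s)^-1) t (- (f t)^-1 ^+ 2 * df).
Proof.
move=> ft0 [df0 <-]; split; first exact: derivableV.
by rewrite derive1E (deriveV ft0 df0) /GRing.scale/= -derive1E exprVn.
Qed.

Lemma is_deriv1_comp f g t df dg : is_deriv1 f (g t) df -> is_deriv1 g t dg ->
  is_deriv1 (fun s => f (g s)) t (df * dg).
Proof.
move=> [/derivable1_diffP hf <-] [/derivable1_diffP hg <-].
split; first exact/derivable1_diffP/differentiable_comp.
rewrite derive1E'; last exact/differentiable_comp.
rewrite diff_comp// /= !derive1E'//.
by rewrite -[X in 'd _ _ X = _]mulr1 [LHS]linearZ mulrC.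
Qed.

Lemma is_deriv1_sum n (h : 'I_n -> F -> F) (dh : 'I_n -> F) t :
  (forall i, is_deriv1 (h i) t (dh i)) ->
  is_deriv1 (fun s => \sum_(i < n) h i s) t (\sum_(i < n) dh i).
Proof.
elim: n h dh => [|n IHn] h dh hh.
  rewrite big_ord0 (_ : (fun s => _) = fun=> 0); first exact: is_deriv1_cst.
  by apply/funext => s; rewrite big_ord0.
rewrite big_ord_recr (_ : (fun s => _) = fun s =>
  \sum_(i < n) h (widen_ord (leqnSn n) i) s + h ord_max s).
  exact: is_deriv1D (IHn _ _ (fun i => hh _)) (hh _).
by apply/funext => s; rewrite big_ord_recr.
Qed.

Lemma is_deriv1_near f g t l : (\near t, f t = g t) ->
  is_deriv1 f t l -> is_deriv1 g t l.
Proof.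
move=> fg /is_deriv1E hf; apply/is_deriv1E; exact: near_eq_is_derive hf.
Qed.

Lemma derive1_near f g t : (\near t, f t = g t) -> derive1 f t = derive1 g t.
Proof. by move=> fg; rewrite !derive1E; exact: near_eq_derive. Qed.

Lemma derivable_continuous f t : derivable f t 1 -> {for t, continuous f}.
Proof. by move=> /derivable1_diffP; exact: differentiable_continuous. Qed.

Lemma open_nbhs_ball I t : open I -> I t ->
  exists2 r, 0 < r & forall z, `|z - t| < r -> I z.
Proof.
move=> oI It; have /nbhs_ballP[r/= r0 rI] := open_nbhs_nbhs (conj oI It).
by exists r => // z zt; apply: rI; rewrite /ball/= distrC.
Qed.

Lemma open_dist_lt t r : open [set z : F | `|z - t| < r].
Proof.
rewrite (_ : [set z | _] = ball t r); first exact: ball_open.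
by apply/seteqP; split=> z; rewrite /ball/= distrC.
Qed.

(** Taking the first derivative off from the inside, unlike [derive1n] in [smooth_on], allows
    induction on the order for products, inverses and composites. *)
Fixpoint Cn1_on n I f : Prop :=
  if n is m.+1 then (forall t, I t -> derivable f t 1) /\ Cn1_on m I (derive1 f)
  else True.

Lemma smooth_onP I f : smooth_on I f <-> forall n, Cn1_on n I f.
Proof.
split=> [sf n|Cf n t It].
  elim: n f sf => // n IHn f sf; split; first by move=> t; exact: sf 0%N t.
  by apply: IHn => m t It; have := sf m.+1 t It; rewrite derive1Sn.
elim: n f Cf => [|n IHn] f Cf; first exact: (Cf 1%N).1.
by rewrite derive1Sn; apply: IHn => m; have [] := Cf m.+1.
Qed.

Section OpenDomain.
Variables (I : set F) (oI : open I).

Lemma open_near f g t : {in I, f =1 g} -> I t -> \near t, f t = g t.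
Proof.
move=> fg It; apply: filterS (open_nbhs_nbhs (conj oI It)) => z Iz.
by apply: fg; rewrite inE.
Qed.

Lemma Cn1_on_eq n f g : {in I, f =1 g} -> Cn1_on n I f -> Cn1_on n I g.
Proof.
elim: n f g => //= n IHn f g fg [df Cf]; split.
  move=> t It; apply: is_deriv1_derivable.
  exact: is_deriv1_near (open_near fg It) (derivable_is_deriv1 (df t It)).
apply: IHn Cf => t; rewrite inE => It; apply: derive1_near.
exact: open_near.
Qed.

Lemma Cn1_on_is_deriv n f df : (forall t, I t -> is_deriv1 f t (df t)) ->
  Cn1_on n I df -> Cn1_on n.+1 I f.
Proof.
move=> fdf Cdf; split; first by move=> t /fdf/is_deriv1_derivable.
by apply: Cn1_on_eq Cdf => t; rewrite inE => /fdf/derive1_val.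
Qed.

Lemma Cn1_onW n f : Cn1_on n.+1 I f -> Cn1_on n I f.
Proof. by elim: n f => // n IHn f [df /IHn]. Qed.

Lemma Cn1_on_der n f t : Cn1_on n.+1 I f -> I t -> is_deriv1 f t (derive1 f t).
Proof. by case=> df _ /df /derivable_is_deriv1. Qed.

Lemma Cn1_on_cst n a : Cn1_on n I (fun=> a).
Proof.
elim: n a => // n IHn a.
exact: Cn1_on_is_deriv (fun t _ => is_deriv1_cst a t) (IHn 0).
Qed.

Lemma Cn1_onD n f g : Cn1_on n I f -> Cn1_on n I g -> Cn1_on n I (fun t => f t + g t).
Proof.
elim: n f g => // n IHn f g Cf Cg.
apply: (@Cn1_on_is_deriv _ _ (fun t => derive1 f t + derive1 g t)).
  by move=> t It; exact: is_deriv1D (Cn1_on_der Cf It) (Cn1_on_der Cg It).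
by apply: IHn; [case: Cf|case: Cg].
Qed.

Lemma Cn1_onM n f g : Cn1_on n I f -> Cn1_on n I g -> Cn1_on n I (fun t => f t * g t).
Proof.
elim: n f g => // n IHn f g Cf Cg.
apply: (@Cn1_on_is_deriv _ _ (fun t => derive1 f t * g t + f t * derive1 g t)).
  by move=> t It; exact: is_deriv1M (Cn1_on_der Cf It) (Cn1_on_der Cg It).
by apply: Cn1_onD; apply: IHn; do ?exact: Cn1_onW; [case: Cf|case: Cg].
Qed.

Lemma Cn1_onV n f : (forall t, I t -> f t != 0) -> Cn1_on n I f ->
  Cn1_on n I (fun t => (f t)^-1).
Proof.
move=> f0; elim: n => // n IHn Cf.
apply: (@Cn1_on_is_deriv _ _ (fun t => -1 * ((f t)^-1 * (f t)^-1) * derive1 f t)).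
  move=> t It; rewrite -expr2 mulN1r; apply: is_deriv1V; first exact: f0.
  exact: Cn1_on_der Cf It.
have CV := IHn (Cn1_onW Cf).
apply: Cn1_onM; last by case: Cf.
by apply: Cn1_onM; [exact: Cn1_on_cst|exact: Cn1_onM].
Qed.

Lemma Cn1_on_comp n J f g : (forall t, I t -> J (g t)) -> Cn1_on n J f ->
  Cn1_on n I g -> Cn1_on n I (fun t => f (g t)).
Proof.
move=> gJ; elim: n f => // n IHn f Cf Cg.
apply: (@Cn1_on_is_deriv _ _ (fun t => derive1 f (g t) * derive1 g t)).
  move=> t It; apply: is_deriv1_comp; last exact: Cn1_on_der Cg It.
  by apply: derivable_is_deriv1; apply: Cf.1; exact: gJ.
apply: Cn1_onM; last by case: Cg.
by apply: IHn; [case: Cf|exact: Cn1_onW].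
Qed.

Lemma smooth_on_eq f g : {in I, f =1 g} -> smooth_on I f -> smooth_on I g.
Proof. by move=> fg /smooth_onP Cf; apply/smooth_onP => n; exact: Cn1_on_eq (Cf n). Qed.

Lemma smooth_on_cst a : smooth_on I (fun=> a).
Proof. by apply/smooth_onP => n; exact: Cn1_on_cst. Qed.

Lemma smooth_onD f g : smooth_on I f -> smooth_on I g ->
  smooth_on I (fun t => f t + g t).
Proof.
by move=> /smooth_onP Cf /smooth_onP Cg; apply/smooth_onP => n; exact: Cn1_onD.
Qed.

Lemma smooth_onM f g : smooth_on I f -> smooth_on I g ->
  smooth_on I (fun t => f t * g t).
Proof.
by move=> /smooth_onP Cf /smooth_onP Cg; apply/smooth_onP => n; exact: Cn1_onM.
Qed.

Lemma smooth_onN f : smooth_on I f -> smooth_on I (fun t => - f t).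
Proof.
move=> sf; apply: smooth_on_eq (smooth_onM (@smooth_on_cst (-1)) sf) => t _.
by rewrite mulN1r.
Qed.

Lemma smooth_onV f : (forall t, I t -> f t != 0) -> smooth_on I f ->
  smooth_on I (fun t => (f t)^-1).
Proof.
by move=> f0 /smooth_onP Cf; apply/smooth_onP => n; exact: Cn1_onV.
Qed.

Lemma smooth_on_comp J f g : (forall t, I t -> J (g t)) -> smooth_on J f ->
  smooth_on I g -> smooth_on I (fun t => f (g t)).
Proof.
move=> gJ /smooth_onP Cf /smooth_onP Cg; apply/smooth_onP => n.
exact: Cn1_on_comp gJ _ _.
Qed.

End OpenDomain.

Lemma smooth_on_derive1 I f : smooth_on I f -> smooth_on I (derive1 f).
Proof. by move=> /smooth_onP Cf; apply/smooth_onP => n; have [] := Cf n.+1. Qed.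

Lemma smooth_on_der I f t : smooth_on I f -> I t -> is_deriv1 f t (derive1 f t).
Proof. by move=> sf It; apply: derivable_is_deriv1; exact: (sf 0%N). Qed.

Lemma smooth_onS I J f : J `<=` I -> smooth_on I f -> smooth_on J f.
Proof. by move=> JI sf n t /JI; exact: sf. Qed.

End Derivatives.

(** * Local inversion of smooth functions *)

Section LocalInverse.
Variable F : numFieldType.
Hypothesis FC : geometrically_complete F.
Implicit Types (f g : F -> F) (t c r l : F) (I J : set F).

(** Mean value inequality with bound 0. It later integrates T_x = 0 and X_xx = 0. *)
Lemma derive1_eq0_cst f c r u : (forall z, `|z - c| < r -> is_deriv1 f z 0) ->
  `|u - c| < r -> f u = f c.
Proof.
move=> f0 uc; apply/eqP; rewrite -subr_eq0 -normr_le0.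
have r0 : `|c - c| < r by rewrite subrr normr0 (le_lt_trans _ uc).
have fM z : `|z - c| < r -> derivable f z 1 /\ `|derive1 f z| <= 0.
  by move=> /f0[df ->]; rewrite normr0.
by have := mean_value_ineq FC fM uc r0; rewrite mul0r.
Qed.

Section Expansion.
Variables (I : set F) (f : F -> F) (t0 c rho : F).
Hypotheses (c0 : c != 0) (rho0 : 0 < rho).
Hypothesis df : forall t, `|t - t0| < rho ->
  derivable f t 1 /\ `|derive1 f t - c| <= `|c| / 2.

(** Mean value inequality for f(t) - c t, whose derivative is at most |c| / 2. *)
Lemma almost_linear u v : `|u - t0| < rho -> `|v - t0| < rho ->
  `|f u - f v - c * (u - v)| <= `|c| / 2 * `|u - v|.
Proof.
move=> ut vt; have := @mean_value_ineq _ FC (fun t => f t + - c * t) t0 rho (`|c| / 2) u v.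
have -> : f u + - c * u - (f v + - c * v) = f u - f v - c * (u - v) by ring.
apply => // z zt; have [dfz lez] := df zt.
have [gz gE] := is_deriv1D (derivable_is_deriv1 dfz)
  (is_deriv1M (is_deriv1_cst (- c) z) (is_deriv1_id z)).
by split=> //; rewrite gE mul0r add0r mulr1.
Qed.

(** Triangle inequality; it gives injectivity of [f] and a Lipschitz bound for its inverse. *)
Lemma expansion u v : `|u - t0| < rho -> `|v - t0| < rho ->
  `|c| / 2 * `|u - v| <= `|f u - f v|.
Proof.
move=> ut vt; have := almost_linear ut vt; rewrite distrC.
have := ler_normD (c * (u - v) - (f u - f v)) (f u - f v); rewrite subrK normrM.
rewrite {1}(splitr `|c|) mulrDl => h1 h2.
have := le_trans h1 (lerD h2 (lexx _)); by rewrite lerD2l.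
Qed.

Lemma derive1_neq0 t : `|t - t0| < rho -> derive1 f t != 0.
Proof.
move=> /df[_]; apply: contraTneq => ->; rewrite sub0r normrN.
by rewrite ler_pdivlMr// mulr_natr mulr2n gerDl normr_le0.
Qed.

(* Newton's iteration with the frozen slope [c]. *)
Lemma local_onto y : `|y - f t0| < `|c| * rho / 4 ->
  exists2 t, `|t - t0| < rho & f t = y.
Proof.
move=> yt; have [_ cauchyF] := FC; have small C e := @geometrically_complete_small F C e FC.
have c1 : 0 < `|c| by rewrite normr_gt0.
pose Phi z := z + (y - f z) / c; pose z n := iter n Phi t0.
(* [d] is the length of the first Newton step; later steps at least halve, so the iteration moves by
   at most 2 d < rho / 2. *)
pose d := `|y - f t0| / `|c|.
have d0 : 0 <= d by rewrite divr_ge0.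
have dlt : 2 * d < rho / 2.
  rewrite /d mulrA ltr_pdivrMr// (_ : rho / 2 * _ = 2 * (`|c| * rho / 4)); last by field.
  by rewrite ltr_pM2l.
have rho2 : rho / 2 < rho by rewrite ltr_pdivrMr// ltr_pMr// ltr1n.
have inrho a : `|a - t0| <= 2 * d -> `|a - t0| < rho.
  by move=> ad; rewrite (le_lt_trans ad)// (lt_trans dlt).
have contr a b : `|a - t0| < rho -> `|b - t0| < rho ->
    `|Phi a - Phi b| <= `|a - b| / 2.
  move=> ad bd; have := almost_linear ad bd; rewrite distrC.
  rewrite (_ : c * _ - _ = c * (Phi a - Phi b)); last by rewrite /Phi; field.
  by rewrite normrM mulrAC -mulrA ler_pM2l// mulrC.
(* The term 2 d / 2^n bounds the sum of the steps still to come, so the iterates never leave the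
   ball of radius 2 d. *)
have zP n : `|z n - t0| + 2 * d * 2 ^- n <= 2 * d /\ `|z n.+1 - z n| <= d * 2 ^- n.
  elim: n => [|n [zn zSn]].
    rewrite expr0 invr1 !mulr1 subrr normr0 add0r; split => //.
    by rewrite /z/= /Phi addrAC subrr add0r normrM normfV.
  have zSn' : `|z n.+1 - t0| + 2 * d * 2 ^- n.+1 <= 2 * d.
    move: (ler_normD (z n.+1 - z n) (z n - t0)); rewrite addrA subrK => tri.
    apply: le_trans zn; move: zSn; rewrite (halfpowS F n) => zSn.
    rewrite (_ : 2 * d * (2 * _) = d * (2 * 2 ^- n.+1) + 2 * d * 2 ^- n.+1); last by ring.
    by rewrite addrA lerD2r addrC; apply: le_trans tri _; rewrite lerD2r.
  split=> //.
  have zn_in : `|z n - t0| < rho.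
    by apply: inrho; apply: le_trans zn; rewrite lerDl !mulr_ge0 ?invr_ge0 ?exprn_ge0 ?ler0n.
  have zSn_in : `|z n.+1 - t0| < rho.
    by apply: inrho; apply: le_trans zSn'; rewrite lerDl !mulr_ge0 ?invr_ge0 ?exprn_ge0 ?ler0n.
  apply: le_trans (contr _ _ zSn_in zn_in) _.
  by rewrite exprSr invfM mulrA ler_pM2r// invr_gt0.
have zK n := (zP n).2; have [l [K lK]] := cauchyF _ _ zK.
have K0 : 0 <= K by have := lK 0%N; rewrite expr0 invr1 mulr1; apply: le_trans.
have lin : `|l - t0| < rho.
  have [|n nlt] := small K (rho / 2) K0; first by rewrite divr_gt0.
  have := ler_normD (l - z n) (z n - t0); rewrite addrA subrK => /le_lt_trans; apply.
  rewrite [ltRHS]splitr; apply: ltrD; first by rewrite distrC (le_lt_trans (lK n)).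
  apply: le_lt_trans dlt; apply: le_trans (zP n).1.
  by rewrite lerDl !mulr_ge0 ?invr_ge0 ?exprn_ge0 ?ler0n.
(* If f l differed from y, then |y - f l| / |c| = |Phi l - l| would be positive, but the contraction
   bounds it by K / 2^n with n as large as desired. *)
exists l => //; apply/eqP; rewrite eq_sym -subr_eq0; apply/negPn/negP => yl.
have e0 : 0 < `|y - f l| / `|c| by rewrite divr_gt0// normr_gt0.
have [n nlt] := small K _ K0 e0.
have : `|y - f l| / `|c| <= K * 2 ^- n.
  rewrite -normfV -normrM (_ : _ / c = (Phi l - Phi (z n)) + (z n.+1 - l)); last first.
    by rewrite /z iterS -/(z n) /Phi; ring.
  have zn_in : `|z n - t0| < rho.
    by apply: inrho; apply: le_trans (zP n).1; rewrite lerDl !mulr_ge0 ?invr_ge0 ?exprn_ge0 ?ler0n.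
  apply: le_trans (ler_normD _ _) _.
  apply: le_trans (lerD (contr _ _ lin zn_in) (lK n.+1)) _.
  rewrite exprSr invfM [in leLHS]mulrA -mulrDl ler_pdivrMr// mulr_natr mulr2n.
  by rewrite lerD2r distrC.
by move=> /(lt_le_trans nlt); rewrite ltxx.
Qed.

End Expansion.

Lemma exists_le_both (a b : F) : 0 < a -> 0 < b -> exists d, [/\ 0 < d, d <= a & d <= b].
Proof.
move=> a0 b0; have [ab|/ltW ba] := real_leP (gtr0_real a0) (gtr0_real b0).
  by exists a.
by exists b.
Qed.

(** On a ball where f' stays within |c| / 2 of c = f'(t0), Newton's iteration supplies preimages and
    expansion makes them unique. *)
Lemma local_inverse I f t0 : open I -> smooth_on I f -> I t0 -> derive1 f t0 != 0 ->
  exists (rho sigma : F) g, [/\ 0 < rho, 0 < sigma,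
    forall y, `|y - f t0| < sigma -> I (g y),
    forall t, `|t - t0| < rho -> `|f t - f t0| < sigma -> g (f t) = t
    & smooth_on [set y | `|y - f t0| < sigma] g].
Proof.
move=> oI sf It0; set c := derive1 f t0 => c0.
have c1 : 0 < `|c| by rewrite normr_gt0.
have [r r0 rI] := open_nbhs_ball oI It0.
have : {for t0, continuous (derive1 f)}.
  exact: derivable_continuous (@smooth_on_derive1 F I f sf 0%N t0 It0).
move=> /cvgrPdist_le/(_ (`|c| / 2) _)/nbhs_ballP.
case=> [|r' /= r'0 r'P]; first by rewrite divr_gt0.
have [rho [rho0 rhor rhor']] := exists_le_both r0 r'0.
have rhoI t : `|t - t0| < rho -> I t by move=> tr; apply: rI; apply: lt_le_trans rhor.
have df t : `|t - t0| < rho -> derivable f t 1 /\ `|derive1 f t - c| <= `|c| / 2.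
  move=> tr; split; first exact: sf 0%N t (rhoI t tr).
  by rewrite distrC; apply: r'P; rewrite /ball/= distrC; apply: lt_le_trans rhor'.
pose sigma := `|c| * rho / 4; have sigma0 : 0 < sigma by rewrite divr_gt0 ?mulr_gt0.
pose J := [set y | `|y - f t0| < sigma].
(* The fallback [t0] is taken only where no preimage exists, hence never on [J]. *)
pose g y := xget t0 [set t | `|t - t0| < rho /\ f t = y].
have gP y : J y -> `|g y - t0| < rho /\ f (g y) = y.
  move=> /(local_onto c0 rho0 df)[t tr ty].
  by have := @xgetPex _ t0 [set t | `|t - t0| < rho /\ f t = y]; apply; exists t.
pose m := `|c| / 2; have m0 : 0 < m by rewrite divr_gt0.
have gder y : J y -> is_deriv1 g y (derive1 f (g y))^-1.
  move=> Jy; have [gyr gyE] := gP y Jy; set t := g y in gyr gyE *.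
  set a := derive1 f t; have a0 := derive1_neq0 c0 df gyr.
  have a1 : 0 < `|a| by rewrite normr_gt0.
  apply/is_deriv1P => e e0.
  (* Dividing by a and passing from |g z - g y| to |z - y| by expansion costs a factor 1 / (|a| m),
     compensated here. *)
  have e'0 : 0 < e * `|a| * m by rewrite mulr_gt0// mulr_gt0.
  have /is_deriv1P/(_ _ e'0)[d d0 dP] := derivable_is_deriv1 (df t gyr).1.
  have [r1 r10 r1P] := open_nbhs_ball (@open_dist_lt F (f t0) sigma) Jy.
  have dm0 : 0 < d * m by rewrite mulr_gt0.
  have [d1 [d10 d1r d1d]] := exists_le_both r10 dm0.
  exists d1 => // z zd1; have [gzr gzE] := gP z (r1P z (lt_le_trans zd1 d1r)).
  have := expansion df gzr gyr; rewrite -/m -/t gzE gyE => exp.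
  have gzd : `|g z - t| < d.
    by rewrite -(ltr_pM2l m0) (le_lt_trans exp)// mulrC (lt_le_trans zd1).
  have := dP _ gzd; rewrite gzE gyE -/a => dz.
  rewrite (_ : g z - t - _ = - a^-1 * (z - y - a * (g z - t))); last by field.
  rewrite normrM normrN normfV mulrC ler_pdivrMr//; apply: le_trans dz _.
  rewrite -mulrA [X in _ <= X]mulrAC ler_pM2l//; exact: mulr_gt0.
exists rho, sigma, g; split => //.
  by move=> y /gP[/rhoI].
  move=> t tr ft; have [gr gE] := gP _ ft.
  apply/eqP; rewrite -subr_eq0 -normr_le0 -(ler_pM2l m0) mulr0.
  by apply: le_trans (expansion df gr tr) _; rewrite gE subrr normr0.
(* Bootstrapping: g' = 1 / f'(g), so regularity of order n of g gives order n + 1. *)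
apply/smooth_onP; elim=> // n IHn.
apply: (Cn1_on_is_deriv (@open_dist_lt F (f t0) sigma) gder).
apply: Cn1_onV; first exact: open_dist_lt.
  by move=> y /gP[gr _]; exact: (derive1_neq0 c0 df gr).
apply: (@Cn1_on_comp _ _ _ _ I) => //; first exact: open_dist_lt.
  by move=> y /gP[gr _]; exact: rhoI.
by have /smooth_onP := smooth_on_derive1 sf.
Qed.

End LocalInverse.

(** * Differential expressions *)

Section DifferentialExpressions.
Variable F : numFieldType.
Implicit Types (f g : F -> F -> F) (t x s : F) (j : nat -> F).

Definition upd j (k : nat) s : nat -> F := fun i => if i == k then s else j i.

Lemma upd_id j k : upd j k (j k) = j.
Proof. by apply/funext => i; rewrite /upd; case: eqP => // ->. Qed.

Lemma upd_neq j k s i : i != k -> upd j k s i = j i.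
Proof. by rewrite /upd => /negPf ->. Qed.

Lemma upd_eq j k s : upd j k s k = s.
Proof. by rewrite /upd eqxx. Qed.

(* [Jet k] is the jet coordinate x^(k+1), and [Dinv] is 1 / D_t T; the
   coordinate x itself only enters through the leaves [Fun f]. *)
Inductive dexpr :=
  | Con of F | Fun of F -> F -> F | Jet of nat
  | Add of dexpr & dexpr | Mul of dexpr & dexpr | Dinv.

Variables (U : set (F * F)) (T : F -> F -> F).
Hypotheses (oU : open U) (sT : smooth2_on U T).

Definition DT t j : F := partial_t T t (j 0%N) + j 1%N * partial_x T t (j 0%N).

(** Working with syntax turns partial and total derivatives of the prolongations into recursive
    functions, so that commutators are computed by induction without any analysis. *)
Fixpoint ev e t j : F :=
  match e with
  | Con c => c
  | Fun f => f t (j 0%N)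
  | Jet k => j k.+1
  | Add a b => ev a t j + ev b t j
  | Mul a b => ev a t j * ev b t j
  | Dinv => (DT t j)^-1
  end.

Fixpoint wf e : Prop :=
  match e with
  | Fun f => smooth2_on U f
  | Add a b | Mul a b => wf a /\ wf b
  | _ => True
  end.

(** Order at most m as a differential function. [Jet k] stands for x^(k+1), whence the strict
    inequality, and [Dinv] contains x^(1). *)
Fixpoint jord e (m : nat) : bool :=
  match e with
  | Jet k => (k < m)%N
  | Add a b | Mul a b => jord a m && jord b m
  | Dinv => (0 < m)%N
  | _ => true
  end.

(* The derivation with prescribed values on the leaves [Fun f] and [Jet k]. *)
Fixpoint dvn (phi : (F -> F -> F) -> dexpr) (psi : nat -> dexpr) e : dexpr :=
  match e with
  | Con _ => Con 0
  | Fun f => phi f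
  | Jet k => psi k
  | Add a b => Add (dvn phi psi a) (dvn phi psi b)
  | Mul a b => Add (Mul (dvn phi psi a) b) (Mul a (dvn phi psi b))
  | Dinv => Mul (Con (-1)) (Mul (Mul Dinv Dinv)
      (Add (phi (partial_t T))
        (Add (Mul (psi 0%N) (Fun (partial_x T))) (Mul (Jet 0) (phi (partial_x T))))))
  end.

(** [pt], [pj k] and [dd] are the formal versions of the derivative by t, the derivative by x^(k)
    and D_t. Among the [pj k], only [pj 0] differentiates the leaves [Fun f]. *)
Definition pt := dvn (fun f => Fun (partial_t f)) (fun=> Con 0).

Definition pj k :=
  if k is i.+1 then dvn (fun=> Con 0) (fun l => Con (l == i)%:R)
  else dvn (fun f => Fun (partial_x f)) (fun=> Con 0).

Definition dd :=
  dvn (fun f => Add (Fun (partial_t f)) (Mul (Jet 0) (Fun (partial_x f))))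
      (fun k => Jet k.+1).

(** The jets over [U] where division by D_t T makes sense and the expressions represent the
    prolongations. *)
Definition Omega t j : Prop := U (t, j 0%N) /\ DT t j != 0.

Definition eqe e e' : Prop := forall t j, Omega t j -> ev e t j = ev e' t j.

Lemma smooth2_on_t f : smooth2_on U f -> smooth2_on U (partial_t f).
Proof. by move=> sf n; have [_ []] := sf n.+1. Qed.

Lemma smooth2_on_x f : smooth2_on U f -> smooth2_on U (partial_x f).
Proof. by move=> sf n; have [_ []] := sf n.+1. Qed.

Lemma smooth2_on_is_deriv_t f t x : smooth2_on U f -> U (t, x) ->
  is_deriv1 (f ^~ x) t (partial_t f t x).
Proof. by move=> sf Utx; have [_ [/(_ _ Utx)]] := sf 1%N. Qed.

Lemma smooth2_on_is_deriv_x f t x : smooth2_on U f -> U (t, x) ->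
  is_deriv1 (f t) x (partial_x f t x).
Proof. by move=> sf Utx; have [_ [_ /(_ _ Utx)]] := sf 1%N. Qed.

Lemma wf_dvn phi psi e : (forall f, smooth2_on U f -> wf (phi f)) ->
  (forall k, wf (psi k)) -> wf e -> wf (dvn phi psi e).
Proof.
move=> wphi wpsi; elim: e => //=.
- by move=> a IHa b IHb [/IHa ? /IHb].
- by move=> a IHa b IHb [? ?]; do ?split=> //; [exact: IHa|exact: IHb].
- move=> _; have sTt := smooth2_on_t sT; have sTx := smooth2_on_x sT.
  by do ?split=> //; [exact: wphi|exact: wphi].
Qed.

Lemma wf_pj k e : wf e -> wf (pj k e).
Proof. by case: k => [|k]; apply: wf_dvn => // f; exact: smooth2_on_x. Qed.

Lemma wf_dd e : wf e -> wf (dd e).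
Proof.
apply: wf_dvn => // f sf; split; first exact: smooth2_on_t.
by split => //; exact: smooth2_on_x.
Qed.

Lemma jordW e m n : (m <= n)%N -> jord e m -> jord e n.
Proof.
move=> mn; elim: e => //=.
- by move=> k /leq_trans; apply.
- by move=> a IHa b IHb /andP[/IHa -> /IHb].
- by move=> a IHa b IHb /andP[/IHa -> /IHb].
- by move=> /leq_trans; apply.
Qed.

Lemma jord_ex e : exists m, jord e m.
Proof.
elim: e; do ?[by exists 1%N].
- by move=> k; exists k.+1 => /=.
- move=> a [m am] b [n bn]; exists (maxn m n) => /=.
  by rewrite (jordW _ am) ?(jordW _ bn) ?leq_maxl ?leq_maxr.
- move=> a [m am] b [n bn]; exists (maxn m n) => /=.
  by rewrite (jordW _ am) ?(jordW _ bn) ?leq_maxl ?leq_maxr.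
Qed.

Lemma jord_dvn phi psi e m n : (m <= n)%N -> (forall f, jord (phi f) n) ->
  (forall k, (k < m)%N -> jord (psi k) n) -> jord e m -> jord (dvn phi psi e) n.
Proof.
move=> mn jphi jpsi; elim: e => //=.
- by move=> a IHa b IHb /andP[/IHa -> /IHb].
- move=> a IHa b IHb /andP[ja jb].
  by rewrite (IHa ja) (IHb jb) (jordW mn ja) (jordW mn jb).
- by move=> m0; rewrite (leq_trans m0 mn) !jphi jpsi.
Qed.

Lemma jord_pj k e m : jord e m -> jord (pj k e) m.
Proof. by case: k => [|k]; apply: jord_dvn. Qed.

Lemma jord_pt e m : jord e m -> jord (pt e) m.
Proof. exact: jord_dvn. Qed.

Lemma jord_dd e m : jord e m -> jord (dd e) m.+1.
Proof. exact: jord_dvn. Qed.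

Lemma ev_jord e m t j j' : jord e m -> (forall k, (k <= m)%N -> j k = j' k) ->
  ev e t j = ev e t j'.
Proof.
move=> + jj'; elim: e => //=.
- by rewrite jj'.
- by move=> k /jj'.
- by move=> a IHa b IHb /andP[/IHa -> /IHb ->].
- by move=> a IHa b IHb /andP[/IHa -> /IHb ->].
- by rewrite /DT => m0; rewrite !jj'.
Qed.

Lemma ev_dvn0 phi psi e m t j : jord e m -> (forall f, ev (phi f) t j = 0) ->
  (forall k, (k < m)%N -> ev (psi k) t j = 0) -> ev (dvn phi psi e) t j = 0.
Proof.
move=> + phi0 psi0; elim: e => //=.
- by move=> a IHa b IHb /andP[/IHa -> /IHb ->]; rewrite addr0.
- by move=> a IHa b IHb /andP[/IHa -> /IHb ->]; rewrite mul0r mulr0 addr0.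
- by move=> m0; rewrite !phi0 psi0// mul0r mulr0 !addr0 !mulr0.
Qed.

Lemma ev_pj0 e m k t j : jord e m -> (m < k)%N -> ev (pj k e) t j = 0.
Proof.
case: k => // k em mk; apply: ev_dvn0 em _ _ => // l lm /=.
by rewrite (ltn_eqF (leq_trans lm mk)).
Qed.

(** A derivation depends linearly on its values on the leaves; for [Dinv] the chain rule is linear
    in them. *)
Lemma ev_dvn_sum n phi psi phi1 psi1 phi2 psi2 (c : 'I_n -> F) e m t j :
  jord e m ->
  (forall f, ev (phi f) t j = ev (phi1 f) t j + \sum_(k < n) c k * ev (phi2 k f) t j) ->
  (forall l, (l < m)%N ->
    ev (psi l) t j = ev (psi1 l) t j + \sum_(k < n) c k * ev (psi2 k l) t j) ->
  ev (dvn phi psi e) t j = ev (dvn phi1 psi1 e) t j +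
    \sum_(k < n) c k * ev (dvn (phi2 k) (psi2 k) e) t j.
Proof.
move=> + hphi hpsi; elim: e => /=.
- by move=> _ _; rewrite big1 ?addr0// => k _; rewrite mulr0.
- by move=> f _; exact: hphi.
- by move=> k km; exact: hpsi.
- move=> a IHa b IHb /andP[/IHa -> /IHb ->].
  rewrite addrACA -big_split/=; congr (_ + _).
  by apply: eq_bigr => k _; rewrite mulrDr.
- move=> a IHa b IHb /andP[/IHa -> /IHb ->].
  rewrite mulrDl mulrDr addrACA mulr_suml mulr_sumr -big_split/=; congr (_ + _).
  by apply: eq_bigr => k _; ring.
- move=> m0; rewrite !hphi hpsi//.
  rewrite [X in _ = _ + X](_ : _ = -1 * ((DT t j)^-1 * (DT t j)^-1 *
    (\sum_(k < n) c k * ev (phi2 k (partial_t T)) t j +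
     ((\sum_(k < n) c k * ev (psi2 k 0%N) t j) * partial_x T t (j 0%N) +
      j 1%N * \sum_(k < n) c k * ev (phi2 k (partial_x T)) t j)))); first by ring.
  rewrite mulr_suml mulr_sumr -!big_split/= !mulr_sumr.
  by apply: eq_bigr => k _; ring.
Qed.

(** The decomposition of D_t only has to be checked on the leaves. [Jet l] receives its value
    x^(l+2) from the summand k = l + 1. *)
Lemma ev_dd e m t j : jord e m ->
  ev (dd e) t j = ev (pt e) t j + \sum_(k < m.+1) j k.+1 * ev (pj k e) t j.
Proof.
move=> em; rewrite (ev_dvn_sum (c := fun k : 'I_m.+1 => j k.+1)
  (phi1 := fun f => Fun (partial_t f)) (psi1 := fun=> Con 0)
  (phi2 := fun k f => if (k : nat) == 0%N then Fun (partial_x f) else Con 0)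
  (psi2 := fun k l => Con (l.+1 == k)%:R) em).
- congr (_ + _); apply: eq_bigr => -[[|k] km] _ //.
- move=> f /=; congr (_ + _); rewrite big_ord_recl/= big1 ?addr0//.
  by move=> k _; rewrite mulr0.
- move=> l lm; rewrite /= add0r (bigD1 (Ordinal (lm : (l.+1 < m.+1)%N)))//= eqxx mulr1.
  rewrite big1 ?addr0// => k kl; rewrite (_ : (l.+1 == k) = false) ?mulr0//.
  by apply/eqP => lk; move/eqP: kl; apply; apply/val_inj.
Qed.

(** A commutator of derivations is again a derivation, so its values on the leaves determine it. *)
Lemma ev_dvn_comm phi psi phi' psi' phi'' psi'' e t j :
  (forall f, ev (dvn phi psi (phi' f)) t j =
    ev (dvn phi' psi' (phi f)) t j + ev (phi'' f) t j) ->
  (forall k, ev (dvn phi psi (psi' k)) t j =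
    ev (dvn phi' psi' (psi k)) t j + ev (psi'' k) t j) ->
  ev (dvn phi psi (dvn phi' psi' e)) t j =
    ev (dvn phi' psi' (dvn phi psi e)) t j + ev (dvn phi'' psi'' e) t j.
Proof.
move=> hphi hpsi; elim: e => //=.
- by rewrite addr0.
- by move=> a -> b ->; ring.
- by move=> a -> b ->; ring.
- rewrite !hphi hpsi; do ![move: (ev _ t j) => ?].
  by move: (DT t j)^-1 (partial_x T t (j 0%N)) (j 1%N) => ? ? ?; ring.
Qed.

(* Unlike for [pj 0], the commutator does not involve mixed partial
   derivatives of the leaves. *)
Lemma ev_pj_dd k e t j :
  ev (pj k.+1 (dd e)) t j = ev (dd (pj k.+1 e)) t j + ev (pj k e) t j.
Proof.
case: k => [|k]; apply: ev_dvn_comm => [f|l] /=.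
- by ring.
- by rewrite add0r.
- by ring.
- by rewrite eqSS add0r.
Qed.

End DifferentialExpressions.

(** * Analytic meaning of the formal derivations *)

Section DifferentialFunctions.
Variable F : numFieldType.
Implicit Types (f g : F -> F -> F) (t x s : F) (j : nat -> F) (e : dexpr F).
Variables (U : set (F * F)) (T : F -> F -> F).
Hypotheses (oU : open U) (sT : smooth2_on U T).

Local Notation ev := (ev T).
Local Notation wf := (wf U).
Local Notation pj := (pj T).
Local Notation pt := (pt T).
Local Notation dd := (dd T).
Local Notation Omega := (Omega U T).
Local Notation eqe := (eqe U T).

(** Chain rule along a curve [tau], [jj] in jet space; the derivatives by t and by x^(k) are the
    cases where a single coordinate moves. *)
Lemma is_deriv1_ev phi psi e (tau : F -> F) (jj : F -> nat -> F) s0 :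
  wf e -> DT T (tau s0) (jj s0) != 0 ->
  (forall f, smooth2_on U f -> is_deriv1 (fun s => f (tau s) (jj s 0%N)) s0
     (ev (phi f) (tau s0) (jj s0))) ->
  (forall k, is_deriv1 (fun s => jj s k.+1) s0 (ev (psi k) (tau s0) (jj s0))) ->
  is_deriv1 (fun s => ev e (tau s) (jj s)) s0
    (ev (dvn T phi psi e) (tau s0) (jj s0)).
Proof.
move=> + D0 hphi hpsi; elim: e => /=.
- by move=> c _; exact: is_deriv1_cst.
- exact: hphi.
- by move=> k _; exact: hpsi.
- by move=> a IHa b IHb [/IHa ha /IHb hb]; exact: is_deriv1D.
- by move=> a IHa b IHb [/IHa ha /IHb hb]; exact: is_deriv1M.
- move=> _; have hTt := hphi _ (smooth2_on_t sT).
  have hTx := hphi _ (smooth2_on_x sT).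
  have := @is_deriv1V _ (fun s => DT T (tau s) (jj s)) _ _ D0
    (is_deriv1D hTt (is_deriv1M (hpsi 0%N) hTx)).
  by rewrite mulN1r expr2 mulNr.
Qed.

Lemma is_deriv1_ev_t e t j : wf e -> Omega t j ->
  is_deriv1 (fun s => ev e s j) t (ev (pt e) t j).
Proof.
move=> we [Utj D0]; apply: (is_deriv1_ev (jj := fun=> j)) => //.
- by move=> f sf; exact: smooth2_on_is_deriv_t.
- by move=> k; exact: is_deriv1_cst.
Qed.

Lemma is_deriv1_ev_j k e t j : wf e -> Omega t j ->
  is_deriv1 (fun s => ev e t (upd j k s)) (j k) (ev (pj k e) t j).
Proof.
move=> we [Utj D0]; rewrite -{3}(upd_id j k).
case: k => [|k]; apply: (is_deriv1_ev (tau := fun=> t)) => //; rewrite ?upd_id//.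
- by move=> f sf; exact: smooth2_on_is_deriv_x.
- by move=> k; exact: is_deriv1_cst.
- by move=> f _; exact: (is_deriv1_cst (f t (j 0%N)) (j k.+1)).
- move=> l; rewrite /upd eqSS /=; case: eqP => _; first exact: is_deriv1_id.
  exact: is_deriv1_cst.
Qed.

Lemma open_box t x : U (t, x) -> exists2 r : F, 0 < r &
  forall s y, `|s - t| < r -> `|y - x| < r -> U (s, y).
Proof.
move=> Utx; have [[A B] /= [nA nB] AB] := open_nbhs_nbhs (conj oU Utx).
have [/= ra ra0 raA] := (nbhs_ballP _ _).1 nA.
have [/= rb rb0 rbB] := (nbhs_ballP _ _).1 nB.
have [r [r0 rra rrb]] := exists_le_both ra0 rb0.
exists r => // s y sr yr; apply: AB; split => /=.
  by apply: raA; rewrite /ball/= distrC (lt_le_trans sr).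
by apply: rbB; rewrite /ball/= distrC (lt_le_trans yr).
Qed.

Let DTe : dexpr F := Add (Fun (partial_t T)) (Mul (Jet F 0) (Fun (partial_x T))).

Let wf_DTe : wf DTe.
Proof. by split; [exact: smooth2_on_t|split => //; exact: smooth2_on_x]. Qed.

Lemma near_Omega_t t j : Omega t j -> \forall s \near t, Omega s j.
Proof.
move=> Otj; have [Utj D0] := Otj.
have cD : {for t, continuous (fun s => DT T s j)}.
  exact: derivable_continuous (is_deriv1_derivable (is_deriv1_ev_t wf_DTe Otj)).
have [r r0 rU] := open_box Utj.
apply: filterS2 (cvgr_neq0 (DT T t j) cD D0) (nbhsx_ballx t r r0) => s Ds sr.
split=> //; apply: rU; first by move: sr; rewrite /ball/= distrC.
by rewrite subrr normr0.
Qed.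

Lemma near_Omega_j k t j : Omega t j -> \forall s \near j k, Omega t (upd j k s).
Proof.
move=> Otj; have [Utj D0] := Otj.
have cD : {for j k, continuous (fun s => DT T t (upd j k s))}.
  exact: derivable_continuous (is_deriv1_derivable (is_deriv1_ev_j k wf_DTe Otj)).
have [r r0 rU] := open_box Utj.
have D0' : DT T t (upd j k (j k)) != 0 by rewrite upd_id.
apply: filterS2 (cvgr_neq0 _ cD D0') (nbhsx_ballx (j k) r r0) => s Ds sr.
split=> //; apply: rU; first by rewrite subrr normr0.
by move: sr; rewrite /upd /ball/= distrC; case: eqP => [->|]; rewrite // subrr normr0.
Qed.

Lemma derive1_t_near e G t j : wf e -> Omega t j ->
  (forall s i, Omega s i -> G s i = ev e s i) ->
  derive1 (G ^~ j) t = ev (pt e) t j.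
Proof.
move=> we Otj GE; rewrite -(derive1_val (is_deriv1_ev_t we Otj)).
by apply: derive1_near; apply: filterS (near_Omega_t Otj) => s /GE.
Qed.

Lemma derive1_j_near k e G t j : wf e -> Omega t j ->
  (forall s i, Omega s i -> G s i = ev e s i) ->
  derive1 (fun s => G t (upd j k s)) (j k) = ev (pj k e) t j.
Proof.
move=> we Otj GE; rewrite -(derive1_val (is_deriv1_ev_j k we Otj)).
by apply: derive1_near; apply: filterS (near_Omega_j k Otj) => s /GE.
Qed.

(** Formal derivations act on syntax, yet respect equality of values on [Omega]: their values are
    actual derivatives, which only depend on nearby values. *)
Lemma eqe_pt e e' : wf e -> wf e' -> eqe e e' -> eqe (pt e) (pt e').
Proof.
move=> we we' ee' t j Otj; rewrite -(derive1_t_near we Otj (fun _ _ _ => erefl)).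
exact: derive1_t_near.
Qed.

Lemma eqe_pj k e e' : wf e -> wf e' -> eqe e e' -> eqe (pj k e) (pj k e').
Proof.
move=> we we' ee' t j Otj; rewrite -(derive1_j_near k we Otj (fun _ _ _ => erefl)).
exact: derive1_j_near.
Qed.

Lemma eqe_dd e e' : wf e -> wf e' -> eqe e e' -> eqe (dd e) (dd e').
Proof.
move=> we we' ee' t j Otj.
have [m em] := jord_ex e; have [m' em'] := jord_ex e'.
have [emm em'm] := (jordW (leq_maxl m m') em, jordW (leq_maxr m m') em').
rewrite (ev_dd _ _ _ emm) (ev_dd _ _ _ em'm) (eqe_pt we we' ee' Otj); congr (_ + _).
by apply: eq_bigr => k _; rewrite (eqe_pj k we we' ee' Otj).
Qed.

Lemma ev_dd0 e t j : wf e -> (forall s i, Omega s i -> ev e s i = 0) ->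
  Omega t j -> ev (dd e) t j = 0.
Proof. by move=> we e0 Otj; rewrite (@eqe_dd e (Con 0)). Qed.

Lemma total_derivativeE m e G t j : wf e -> jord e m -> Omega t j ->
  (forall s i, Omega s i -> G s i = ev e s i) ->
  total_derivative m G t j = ev (dd e) t j.
Proof.
move=> we em Otj GE; rewrite /total_derivative (ev_dd _ _ _ em).
rewrite (derive1_t_near we Otj GE); congr (_ + _); apply: eq_bigr => k _.
rewrite -(derive1_j_near k we Otj GE); congr (_ * _).
Qed.

Lemma total_derivative_DT t j : total_derivative 0 (on_jets T) t j = DT T t j.
Proof.
rewrite /total_derivative big_ord1/= /DT /partial_t /partial_x.
congr (_ + _ * _).

Qed.

Variables (X : F -> F -> F) (sX : smooth2_on U X).

Fixpoint pe k : dexpr F := if k is i.+1 then Mul (dd (pe i)) (Dinv F) else Fun X.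

Lemma wf_pe k : wf (pe k).
Proof. by elim: k => //= k IHk; split=> //; exact: wf_dd. Qed.

Lemma jord_pe k : jord (pe k) k.
Proof. by elim: k => //= k IHk; rewrite jord_dd. Qed.

Lemma prolongationE k t j : Omega t j -> prolongation T X k t j = ev (pe k) t j.
Proof.
elim: k t j => // k IHk t j Otj.
rewrite [LHS]/= (total_derivativeE (wf_pe k) (jord_pe k) Otj IHk).
by rewrite total_derivative_DT.
Qed.

End DifferentialFunctions.

(** * Leading and subleading coefficients of the prolonged derivatives *)

Section TopCoefficients.
Variable F : numFieldType.
Implicit Types (f g : F -> F -> F) (t x s : F) (j : nat -> F) (e : dexpr F).
Variables (U : set (F * F)) (T X : F -> F -> F).
Hypotheses (oU : open U) (sT : smooth2_on U T) (sX : smooth2_on U X).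

Local Notation ev := (ev T).
Local Notation wf := (wf U).
Local Notation pj := (pj T).
Local Notation dd := (dd T).
Local Notation Omega := (Omega U T).
Local Notation eqe := (eqe U T).
Local Notation pe := (pe T X).

Fixpoint Dinvn n : dexpr F := if n is m.+1 then Mul (Dinv F) (Dinvn m) else Con 1.

Definition jac : dexpr F :=
  Add (Mul (Fun (partial_t T)) (Fun (partial_x X)))
      (Mul (Con (-1)) (Mul (Fun (partial_x T)) (Fun (partial_t X)))).

Lemma wf_Dinvn n : wf (Dinvn n).
Proof. by elim: n => //= n. Qed.

Lemma wf_jac : wf jac.
Proof.
have [? ?] := (smooth2_on_t sT, smooth2_on_x sT).
by have [? ?] := (smooth2_on_t sX, smooth2_on_x sX).
Qed.

Lemma ev_Dinvn n t j : ev (Dinvn n) t j = (DT T t j)^-1 ^+ n.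
Proof. by elim: n => //= n ->; rewrite exprS. Qed.

Lemma jord_Dinvn n : jord (Dinvn n) 1.
Proof. by elim: n. Qed.

Lemma ev_pj1_Dinvn n t j : ev (pj 1 (Dinvn n)) t j =
  - (n%:R * partial_x T t (j 0%N) * (DT T t j)^-1 ^+ n.+1).
Proof.
elim: n => [|n IHn] /=; first by rewrite !mul0r oppr0.
by rewrite [ev (dvn _ _ _ _) t j]IHn ev_Dinvn -natr1 !exprS; ring.
Qed.

Lemma evM e e' t j : ev (Mul e e') t j = ev e t j * ev e' t j.
Proof. by []. Qed.

Lemma evD e e' t j : ev (Add e e') t j = ev e t j + ev e' t j.
Proof. by []. Qed.

Lemma ev_pjD k e e' t j : ev (pj k (Add e e')) t j = ev (pj k e) t j + ev (pj k e') t j.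
Proof. by case: k. Qed.

Lemma ev_pjM k e e' t j : ev (pj k (Mul e e')) t j =
  ev (pj k e) t j * ev e' t j + ev e t j * ev (pj k e') t j.
Proof. by case: k. Qed.

Lemma ev_pj_Dinv k t j : (1 < k)%N -> ev (pj k (Dinv F)) t j = 0.
Proof. by move=> k1; apply: (@ev_pj0 _ _ _ 1). Qed.

Lemma wf_pj_pe k m : wf (pj k (pe m)).
Proof. by apply: wf_pj => //; exact: wf_pe. Qed.

Lemma ev_pj_pe k m t j : ev (pj k (pe m.+1)) t j =
  ev (pj k (dd (pe m))) t j * (DT T t j)^-1 + ev (dd (pe m)) t j * ev (pj k (Dinv F)) t j.
Proof. exact: ev_pjM. Qed.

Lemma ev_pj_peS k m t j : (0 < k)%N -> ev (pj k.+1 (pe m.+1)) t j =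
  (ev (dd (pj k.+1 (pe m))) t j + ev (pj k (pe m)) t j) * (DT T t j)^-1.
Proof. by move=> k0; rewrite ev_pjM ev_pj_Dinv// mulr0 addr0 ev_pj_dd. Qed.

Lemma ev_jac t j : ev jac t j =
  partial_t T t (j 0%N) * partial_x X t (j 0%N) -
  partial_x T t (j 0%N) * partial_t X t (j 0%N).
Proof. by rewrite /= mulN1r. Qed.

(** Quotient rule for (X_t + x^(1) X_x) / (T_t + x^(1) T_x): in the numerator the terms with x^(1)
    cancel and leave the Jacobian. *)
Lemma ev_pj1_pe1 t j : Omega t j ->
  ev (pj 1 (pe 1)) t j = ev jac t j * (DT T t j)^-1 ^+ 2.
Proof.
by move=> [_]; rewrite /DT => D0; rewrite /= /DT; field.
Qed.

(** A_k = Delta / (D_t T)^(k+1). The commutator turns the derivative of D_t P_k by x^(k+1) into that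
    of P_k by x^(k), since P_k does not contain x^(k+1). *)
Lemma pj_pe_top k t j : (0 < k)%N -> Omega t j ->
  ev (pj k (pe k)) t j = ev (Mul jac (Dinvn k.+1)) t j.
Proof.
elim: k t j => // -[_ t j _ Otj|k IHk t j _ Otj].
  by rewrite ev_pj1_pe1// evM ev_Dinvn.
rewrite ev_pj_peS// (ev_dd0 oU sT)//; [|exact: wf_pj_pe|].
  rewrite add0r IHk// evM [in RHS]evM !ev_Dinvn.
  by rewrite [in RHS]exprS; ring.
by move=> s i _; apply: (@ev_pj0 _ _ _ k.+1) => //; exact: jord_pe.
Qed.

(** The recursion B_(k+1) = (D_t A_(k+1) + B_k) / D_t T, with the closed form of A_(k+1)
    inserted. *)
Definition sub_coef k : dexpr F :=
  Mul (Add (dd (Mul jac (Dinvn k.+2))) (pj k (pe k.+1))) (Dinv F).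

Lemma wf_sub_coef k : wf (sub_coef k).
Proof.
split=> //; split; last exact: wf_pj_pe.
by apply: wf_dd => //; split; [exact: wf_jac|exact: wf_Dinvn].
Qed.

Lemma pj_pe_sub k : (0 < k)%N -> eqe (pj k.+1 (pe k.+2)) (sub_coef k).
Proof.
move=> k0 t j Otj; rewrite ev_pj_peS// evM evD; congr ((_ + _) * _).
apply: (eqe_dd oU sT _ _ _ Otj); first exact: wf_pj_pe.
  by split; [exact: wf_jac|exact: wf_Dinvn].
by move=> s i; exact: pj_pe_top.
Qed.

(** For B_1 there is an extra term, as 1 / D_t T contains x^(1). *)
Let sub_coef1 : dexpr F :=
  Add (Mul (Add (dd (Mul jac (Dinvn 2))) (pj 0 (pe 1))) (Dinv F))
      (Mul (dd (pe 1)) (pj 1 (Dinv F))).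

Let wf_sub_coef1 : wf sub_coef1.
Proof.
split; first split => //.
  split; last exact: wf_pj_pe.
  by apply: wf_dd => //; split; [exact: wf_jac|exact: wf_Dinvn].
by split; [apply: wf_dd => //; exact: wf_pe|exact: wf_pj].
Qed.

Let pj_pe_sub1 : eqe (pj 1 (pe 2)) sub_coef1.
Proof.
move=> t j Otj; rewrite ev_pj_pe ev_pj_dd.
rewrite [RHS]evD [X in _ = X + _]evM [X in _ = _ + X]evM [X in _ = X * _ + _]evD.
congr ((_ + _) * _ + _).
apply: (eqe_dd oU sT _ _ _ Otj); first exact: wf_pj_pe.
  by split; [exact: wf_jac|exact: wf_Dinvn].
by move=> s i; exact: pj_pe_top.
Qed.

Lemma ev_pj1_Dinv t j :
  ev (pj 1 (Dinv F)) t j = - (partial_x T t (j 0%N) * (DT T t j)^-1 ^+ 2).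
Proof. by rewrite /=; ring. Qed.

Lemma ev_pj1_top n t j : ev (pj 1 (Mul jac (Dinvn n))) t j =
  - (n%:R * ev jac t j * partial_x T t (j 0%N) * (DT T t j)^-1 ^+ n.+1).
Proof.
rewrite ev_pjM ev_pj1_Dinvn (_ : ev (pj 1 jac) t j = 0); last by rewrite /=; ring.
by rewrite mul0r add0r; move: (ev jac t j) => J; ring.
Qed.

Lemma ev_pj2_dd_top n t j : Omega t j ->
  ev (pj 2 (dd (Mul jac (Dinvn n)))) t j =
  - (n%:R * ev jac t j * partial_x T t (j 0%N) * (DT T t j)^-1 ^+ n.+1).
Proof.
move=> Otj; rewrite ev_pj_dd (ev_dd0 oU sT) ?add0r ?ev_pj1_top//.
  by apply: wf_pj => //; split; [exact: wf_jac|exact: wf_Dinvn].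
by move=> s i _; apply: (@ev_pj0 _ _ _ 1) => //; rewrite /= jord_Dinvn.
Qed.

(** In the recursion, D_t A_k adds k + 1 to the coefficient, in accordance with C(k+2,2) = C(k+1,2)
    + (k+1). The start is 3 = 2 + 1, where 1 comes from the extra term of B_1. *)
Lemma ev_pj2_sub k t j : (0 < k)%N -> Omega t j ->
  ev (pj 2 (pj k (pe k.+1))) t j =
  - ('C(k.+2, 2)%:R * ev jac t j * partial_x T t (j 0%N) * (DT T t j)^-1 ^+ k.+3).
Proof.
elim: k t j => // -[_ t j _ Otj|k IHk t j _ Otj].
  rewrite (eqe_pj oU sT 2 (wf_pj_pe _ _) wf_sub_coef1 pj_pe_sub1 Otj).
  rewrite ev_pjD [X in X + _]ev_pjM [X in _ + X]ev_pjM ev_pj_Dinv// ev_pjD ev_pj2_dd_top// ev_pj1_Dinv.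
  rewrite ev_pj_dd (ev_dd0 oU sT)//; last 2 first.
  - exact: wf_pj_pe.
  - by move=> s i _; apply: (@ev_pj0 _ _ _ 1) => //; exact: jord_pe.
  rewrite (@ev_pj0 _ _ (pj 0 (pe 1)) 1) ?jord_pj ?jord_pe//.
  rewrite (@ev_pj0 _ _ (pj 1 (Dinv F)) 1) ?jord_pj//.
  rewrite pj_pe_top// evM ev_Dinvn (_ : 'C(3, 2) = 3%N)//.
  by rewrite [ev (Dinv F) t j]/=; move: (ev jac t j) => J; ring.
rewrite (eqe_pj oU sT 2 (wf_pj_pe _ _) (wf_sub_coef _) (@pj_pe_sub k.+1 isT) Otj).
rewrite ev_pjM ev_pj_Dinv// mulr0 addr0 ev_pjD IHk// ev_pj2_dd_top//.
rewrite [in RHS]binS bin1 natrD [ev (Dinv F) t j]/=.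
by rewrite [in RHS]exprS; move: (ev jac t j) => J; ring.
Qed.

(** * The subleading coefficients in the case T_x = 0 *)

Section FiberPreserving.
Hypotheses (Tx0 : forall p, U p -> partial_x T p.1 p.2 = 0)
  (Ttx0 : forall p, U p -> partial_x (partial_t T) p.1 p.2 = 0).

Let Tx0' t j : Omega t j -> partial_x T t (j 0%N) = 0.
Proof. by case=> /Tx0. Qed.

Let pj1_Dinv0 : eqe (pj 1 (Dinv F)) (Con 0).
Proof. by move=> t j /Tx0' Tx; rewrite ev_pj1_Dinv Tx mul0r oppr0. Qed.

(** The derivative of 1 / D_t T by x involves T_tx, zero by assumption, and T_xx, zero because T_x
    vanishes on an open set. *)
Let pj0_Dinv0 : eqe (pj 0 (Dinv F)) (Con 0).
Proof.
move=> t j Otj; have [/Ttx0/= Ttx _] := Otj.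
have Txx : ev (pj 0 (Fun (partial_x T))) t j = ev (pj 0 (Con 0)) t j.
  by apply: (eqe_pj oU sT 0 _ _ _ Otj) => //; exact: smooth2_on_x.
by move: Txx; rewrite /= Ttx => ->; ring.
Qed.

Let ev_pj0_Dinvn n t j : Omega t j -> ev (pj 0 (Dinvn n)) t j = 0.
Proof.
move=> Otj; elim: n => // n IHn.
by rewrite ev_pjM IHn pj0_Dinv0//= mul0r mulr0 addr0.
Qed.

Let top' n : dexpr F := Mul (Fun (partial_x X)) (Dinvn n).

Let wf_top n : wf (Mul jac (Dinvn n)).
Proof. by split; [exact: wf_jac|exact: wf_Dinvn]. Qed.

Let wf_top' n : wf (top' n).
Proof. by split; [exact: smooth2_on_x|exact: wf_Dinvn]. Qed.

(** Here D_t T = T_t and Delta = T_t X_x, so one factor cancels. *)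
Let topE n : eqe (Mul jac (Dinvn n.+1)) (top' n).
Proof.
move=> t j Otj; rewrite [LHS]evM ev_jac [RHS]evM !ev_Dinvn; have [_] := Otj.
by rewrite /DT (Tx0' Otj) exprS mulr0 addr0 /= => D0; field.
Qed.

Let ev_pj1_dd_top n t j : Omega t j -> ev (pj 1 (dd (Mul jac (Dinvn n.+1)))) t j =
  partial_x (partial_x X) t (j 0%N) * (DT T t j)^-1 ^+ n.
Proof.
move=> Otj; rewrite (eqe_pj oU sT 1 (wf_dd sT (wf_top _)) (wf_dd sT (wf_top' _))
  (eqe_dd oU sT (wf_top _) (wf_top' _) (@topE n)) Otj).
rewrite ev_pj_dd (ev_dd0 oU sT)//; last 2 first.
- exact: wf_pj.
- move=> s i Osi; rewrite ev_pjM ev_pj1_Dinvn (Tx0' Osi).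
  by rewrite /= mul0r add0r mulr0 mul0r oppr0 mulr0.
by rewrite add0r ev_pjM ev_pj0_Dinvn// mulr0 addr0 ev_Dinvn.
Qed.

(** B_k collects one X_xx from each of D_t A_1, ..., D_t A_k and one from the derivative of P_1 by
    x, hence k + 1 in all. *)
Lemma ev_pj1_sub k t j : (0 < k)%N -> Omega t j ->
  ev (pj 1 (pj k (pe k.+1))) t j =
  k.+1%:R * partial_x (partial_x X) t (j 0%N) * (DT T t j)^-1 ^+ k.+1.
Proof.
elim: k t j => // -[_ t j _ Otj|k IHk t j _ Otj].
  rewrite (eqe_pj oU sT 1 (wf_pj_pe _ _) wf_sub_coef1 pj_pe_sub1 Otj).
  rewrite ev_pjD [X in X + _]ev_pjM [X in _ + X]ev_pjM ev_pjD ev_pj1_dd_top//.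
  rewrite (eqe_pj oU sT 1 (wf_pj sT 1 (e := Dinv F) I) _ pj1_Dinv0 Otj)// pj1_Dinv0//.
  have -> : ev (pj 1 (pj 0 (pe 1))) t j =
      partial_x (partial_x X) t (j 0%N) * (DT T t j)^-1.
    have pe1E : eqe (pj 0 (pe 1)) (Mul (pj 0 (dd (Fun X))) (Dinv F)).
      by move=> s i Osi; rewrite ev_pjM pj0_Dinv0//= mulr0 addr0.
    rewrite (eqe_pj oU sT 1 _ _ pe1E Otj)//; last 2 first.
    - exact: wf_pj_pe.
    - by split=> //; apply: wf_pj => //; exact: wf_dd.
    rewrite ev_pjM pj1_Dinv0// mulr0 addr0; congr (_ * _); rewrite /=.
    by rewrite !(mul0r, mul1r, mulr0, add0r, addr0).
  rewrite [ev (Con 0) t j]/= [ev (Dinv F) t j]/= !mulr0 !addr0.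
  by move: (partial_x (partial_x X) t _) (DT T t j)^-1 => u v; ring.
rewrite (eqe_pj oU sT 1 (wf_pj_pe _ _) (wf_sub_coef _) (@pj_pe_sub k.+1 isT) Otj).
rewrite ev_pjM ev_pjD IHk// ev_pj1_dd_top// pj1_Dinv0//.
rewrite [ev (Con 0) t j]/= [ev (Dinv F) t j]/= mulr0 addr0.
rewrite -[in RHS]natr1 [in RHS]exprS.
by move: (partial_x (partial_x X) t _) (DT T t j)^-1 => u v; ring.
Qed.

End FiberPreserving.

End TopCoefficients.

(** * Consequences of linearity *)

Section NecessaryConditions.
Variable F : numFieldType.
Implicit Types (t x s : F) (j : nat -> F).
Variables (U : set (F * F)) (T X : F -> F -> F).
Hypotheses (oU : open U) (sT : smooth2_on U T) (sX : smooth2_on U X).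

Local Notation ev := (ev T).
Local Notation pj := (pj T).
Local Notation dd := (dd T).
Local Notation Omega := (Omega U T).
Local Notation pe := (pe T X).
Local Notation jac := (jac T X).

(** In D_t, the top variable x^(m+1) only occurs as the factor of the derivative by x^(m). *)
Lemma ev_dd_affine e m t j j' : jord e m -> (forall k, (k <= m)%N -> j' k = j k) ->
  ev (dd e) t j' = ev (dd e) t j + (j' m.+1 - j m.+1) * ev (pj m e) t j.
Proof.
move=> em jj'; rewrite !(ev_dd _ _ _ em) !big_ord_recr/=.
rewrite (ev_jord T t (jord_pt T em) jj').
rewrite (ev_jord T t (jord_pj T m em) jj') -!addrA; congr (_ + _).
rewrite -mulrDl [j m.+1 + _]addrC subrK; congr (_ + _).
apply: eq_bigr => k _; rewrite jj'//; congr (_ * _).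
exact: ev_jord (jord_pj T k em) jj'.
Qed.

Variables (n : nat) (a b : 'I_n.+1 -> F -> F).
Hypotheses (n2 : (1 < n)%N) (mapsU : maps_ode U T X a b).

(* Differentiate the transformed equation with respect to x^(n) along the
   equation, i.e., with x^(n+1) expressed through the lower derivatives. *)
Lemma sub_coef_relation t j : Omega t j -> j n.+1 = 0 ->
  ev (pj n (pe n.+1)) t j =
  a ord_max t * (ev jac t j * (DT T t j)^-1 ^+ n.+2) -
  b ord_max (T t (j 0%N)) * (ev jac t j * (DT T t j)^-1 ^+ n.+1).
Proof.
move=> Otj jn0; have [Utj D0] := Otj.
(* [js] varies x^(n) alone; [Js] completes it to a jet on the original equation by solving for
   x^(n+1). As n >= 2, the values of t, x and x^(1) stay fixed, so Delta and D_t T are constant in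
   s. *)
pose js s := upd j n s.
pose Js s := upd (js s) n.+1 (- \sum_(k < n.+1) a k t * js s k).
have jsE s k : (k < n)%N -> js s k = j k by move=> kn; rewrite /js upd_neq ?ltn_eqF.
have JsE s k : (k <= n)%N -> Js s k = js s k.
  by move=> kn; rewrite /Js upd_neq// ltn_eqF.
have n0 : (0 < n)%N by exact: ltnW.
have Ojs s : Omega t (js s).
  by rewrite /Omega /DT !jsE.
have OJs s : Omega t (Js s).
  by rewrite /Omega /DT !JsE ?jsE.
have A j' : (forall k, (k < n)%N -> j' k = j k) -> Omega t j' ->
    ev (pj n (pe n)) t j' = ev jac t j * (DT T t j)^-1 ^+ n.+1.
  move=> jj' Oj'; rewrite (pj_pe_top oU sT sX)// evM ev_Dinvn /DT !jj'//.
  by rewrite !ev_jac !jj'.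
(* The transformed equation along [Js], with P_(n+1) expanded around [js], where x^(n+1) = 0. *)
have H s : ev (pe n.+1) t (js s) +
    (- \sum_(k < n.+1) a k t * js s k) * (ev jac t j * (DT T t j)^-1 ^+ n.+2) +
    \sum_(k < n.+1) b k (T t (j 0%N)) * ev (pe k) t (js s) = 0.
  have : linear_ode_lhs a t (Js s) = 0.
    rewrite /linear_ode_lhs {1}/Js upd_eq addrC -sumrN -big_split big1//= => k _.
    by rewrite JsE ?subrr// -ltnS.
  have [UJ DJ] := OJs s; rewrite (mapsU UJ); last by rewrite total_derivative_DT.
  rewrite /linear_ode_lhs (prolongationE oU sT sX _ (OJs s)) JsE// jsE//.
  move=> E; rewrite -[RHS]E; congr (_ + _); last first.
    apply: eq_bigr => k _; rewrite (prolongationE oU sT sX _ (OJs s)).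
    congr (_ * _); apply: ev_jord (jord_pe T X k) _ => l lk.
    by rewrite JsE// (leq_trans lk)// -ltnS.
  rewrite evM [RHS]evM (ev_dd_affine t (jord_pe T X n) (j' := Js s) (j := js s)); last exact: JsE.
  rewrite A//; last exact: jsE.
  have -> : ev (Dinv F) t (js s) = (DT T t j)^-1 by rewrite /= /DT !jsE.
  have -> : ev (Dinv F) t (Js s) = (DT T t j)^-1 by rewrite /= /DT !JsE ?jsE.
  have -> : js s n.+1 = 0 by rewrite /js upd_neq// gtn_eqF.
  have -> : Js s n.+1 = - \sum_(k < n.+1) a k t * js s k by rewrite /Js upd_eq.
  rewrite subr0 [_ ^+ n.+2]exprSr.
  move: (ev jac t j) (ev (dd _) t _) (\sum_(k < n.+1) a k t * js s k) => J P S.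
  by ring.
(* The left-hand side of [H] is the zero function of s, so its derivative, computed term by term,
   must vanish. *)
have dH : is_deriv1 (fun=> 0) (j n) (ev (pj n (pe n.+1)) t j +
    (- \sum_(k < n.+1) a k t * (k == n :> nat)%:R) * (ev jac t j * (DT T t j)^-1 ^+ n.+2) +
    \sum_(k < n.+1) b k (T t (j 0%N)) * ev (pj n (pe k)) t j).
  rewrite -[X in is_deriv1 X](_ : (fun s => ev (pe n.+1) t (js s) +
    (- \sum_(k < n.+1) a k t * js s k) * (ev jac t j * (DT T t j)^-1 ^+ n.+2) +
    \sum_(k < n.+1) b k (T t (j 0%N)) * ev (pe k) t (js s)) = _); last first.
    by apply/funext.
  have dpe k : is_deriv1 (fun s => ev (pe k) t (js s)) (j n) (ev (pj n (pe k)) t j).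
    exact: (is_deriv1_ev_j sT n (wf_pe sT sX k) Otj).
  have dcM (c : F) f l : is_deriv1 f (j n) l -> is_deriv1 (fun s => c * f s) (j n) (c * l).
    by move=> df; have := is_deriv1M (is_deriv1_cst c (j n)) df; rewrite mul0r add0r.
  have dS : is_deriv1 (fun s => - \sum_(k < n.+1) a k t * js s k) (j n)
      (- \sum_(k < n.+1) a k t * (k == n :> nat)%:R).
    apply: is_deriv1N; apply: is_deriv1_sum => k; apply: dcM.
    rewrite /js /upd; case: eqP => _ /=; first exact: is_deriv1_id.
    exact: is_deriv1_cst.
  have := is_deriv1M dS (is_deriv1_cst (ev jac t j * (DT T t j)^-1 ^+ n.+2) (j n)).
  rewrite mulr0 addr0 => dS'; apply: is_deriv1D; first exact: is_deriv1D.
  by apply: is_deriv1_sum => k; apply: dcM.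
have := derive1_val dH; rewrite (derive1_val (is_deriv1_cst _ _)) => /esym.
have -> : \sum_(k < n.+1) a k t * (k == n :> nat)%:R = a ord_max t.
  rewrite big_ord_recr/= eqxx mulr1 big1 ?add0r// => k _.
  by rewrite ltn_eqF// mulr0.
have -> : \sum_(k < n.+1) b k (T t (j 0%N)) * ev (pj n (pe k)) t j =
    b ord_max (T t (j 0%N)) * ev (pj n (pe n)) t j.
  rewrite big_ord_recr big1 ?[LHS]add0r// => k _.
  by rewrite (@ev_pj0 _ _ _ k) ?mulr0//; exact: jord_pe.
rewrite A// => E; apply/eqP; rewrite -subr_eq0 -[X in _ == X]E; apply/eqP.
by move: (ev jac t j) (ev (pj n _) t j) => J P; ring.
Qed.

(** The relation makes B_n independent of x^(2), while its derivative by x^(2) is a nonzero multiple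
    of T_x. *)
Lemma partial_x_T_eq0 p : ev jac p.1 (fun=> p.2) != 0 -> U p -> partial_x T p.1 p.2 = 0.
Proof.
case: p => t x /= J0 Utx.
(* As the Jacobian does not vanish, T_t and T_x are not both 0, so D_t T is nonzero for x^(1) = 0 or
   for x^(1) = 1. *)
have [p D0] : exists p, partial_t T t x + p * partial_x T t x != 0.
  have [Tt0|Tt0] := eqVneq (partial_t T t x) 0; last by exists 0; rewrite mul0r addr0.
  exists 1; rewrite mul1r Tt0 add0r; apply: contra_neq J0 => ->.
  by rewrite Tt0 !mul0r mulr0 addr0.
pose j k : F := if k is k'.+1 then if k' is 0%N then p else 0 else x.
have Otj : Omega t j by [].
have jn : j n.+1 = 0 by rewrite /j; case: (n) n2.
have dB : is_deriv1 (fun s => ev (pj n (pe n.+1)) t (upd j 2 s)) (j 2)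
    (ev (pj 2 (pj n (pe n.+1))) t j).
  by apply: (is_deriv1_ev_j sT 2 _ Otj); exact: wf_pj_pe.
have : ev (pj 2 (pj n (pe n.+1))) t j = 0.
  rewrite -(derive1_val dB) -[RHS](derive1_val (is_deriv1_cst
    (a ord_max t * (ev jac t j * (DT T t j)^-1 ^+ n.+2) -
     b ord_max (T t (j 0%N)) * (ev jac t j * (DT T t j)^-1 ^+ n.+1)) (j 2))).
  congr (derive1 _ _); apply/funext => s; rewrite sub_coef_relation//.
  by rewrite upd_neq// eqSS gtn_eqF.
rewrite (ev_pj2_sub oU sT sX)//; last exact: ltnW.
move/eqP; rewrite oppr_eq0 mulf_eq0 expf_eq0 invr_eq0 (negPf D0) andbF orbF.
by rewrite mulf_eq0 mulf_eq0 pnatr_eq0 (negPf J0) orbF eqn0Ngt bin_gt0 => /eqP.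
Qed.

(** With T_x = 0 the right-hand side of the relation is free of x^(1) too, while the derivative of
    B_n by x^(1) is (n + 1) X_xx / T_t^(n+1). *)
Lemma partial_xx_X_eq0 p : (forall q, U q -> partial_x T q.1 q.2 = 0) ->
  (forall q, U q -> partial_x (partial_t T) q.1 q.2 = 0) ->
  ev jac p.1 (fun=> p.2) != 0 -> U p -> partial_x (partial_x X) p.1 p.2 = 0.
Proof.
move=> Tx0 Ttx0; case: p => t x /= J0 Utx.
pose j k : F := if k is k'.+1 then 0 else x.
have Tx0' s : partial_x T t (upd j 1 s 0%N) = 0 by exact: Tx0 Utx.
have DE s : DT T t (upd j 1 s) = DT T t j by rewrite /DT !Tx0' !mulr0.
have Otj : Omega t j.
  split=> //; apply: contra_neq J0.
  have Tx : partial_x T t x = 0 by exact: (Tx0 (t, x) Utx).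
  by rewrite /DT /= Tx mulr0 addr0 => ->; rewrite !mul0r mulr0 addr0.
have dB : is_deriv1 (fun s => ev (pj n (pe n.+1)) t (upd j 1 s)) (j 1)
    (ev (pj 1 (pj n (pe n.+1))) t j).
  by apply: (is_deriv1_ev_j sT 1 _ Otj); exact: wf_pj_pe.
have : ev (pj 1 (pj n (pe n.+1))) t j = 0.
  rewrite -(derive1_val dB) -[RHS](derive1_val (is_deriv1_cst
    (a ord_max t * (ev jac t j * (DT T t j)^-1 ^+ n.+2) -
     b ord_max (T t (j 0%N)) * (ev jac t j * (DT T t j)^-1 ^+ n.+1)) (j 1))).
  congr (derive1 _ _); apply/funext => s; rewrite sub_coef_relation ?DE//.
  - by split=> //; rewrite DE; case: Otj.
  - by rewrite upd_neq// eqSS gtn_eqF// ltnW.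
rewrite (ev_pj1_sub oU sT sX Tx0 Ttx0)//; last exact: ltnW.
move/eqP; rewrite mulf_eq0 expf_eq0 invr_eq0 (negPf (proj2 Otj)) andbF orbF.
by rewrite mulf_eq0 pnatr_eq0 => /eqP.
Qed.

End NecessaryConditions.

(** * Transformations with T = T(t) and X affine in x *)

Section AffineTransformation.
Variable F : numFieldType.
Implicit Types (t x s : F) (j : nat -> F).
Variables (V : set (F * F)) (I : set F) (T X : F -> F -> F) (T0 X1 X0 : F -> F).
Hypotheses (oV : open V) (oI : open I) (VI : forall p, V p -> I p.1).
Hypotheses (sT0 : smooth_on I T0) (sX1 : smooth_on I X1) (sX0 : smooth_on I X0).
Hypothesis TX1_neq0 : forall t, I t -> derive1 T0 t * X1 t != 0.
Hypothesis TXE : forall t x, V (t, x) -> T t x = T0 t /\ X t x = X1 t * x + X0 t.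

Let y t := X0 t / X1 t.

(* The k-th prolonged derivative is \sum_(i <= k) pcoef k i * (x + y)^(i). *)
Fixpoint pcoef k i : F -> F :=
  if k is m.+1 then
    fun t => (derive1 (pcoef m i) t + (if i is l.+1 then pcoef m l t else 0)) * (derive1 T0 t)^-1
  else if i is 0%N then X1 else fun=> 0.

Lemma X1_neq0 t : I t -> X1 t != 0.
Proof. by move=> /TX1_neq0; rewrite mulf_eq0 negb_or => /andP[]. Qed.

Lemma derive1_T0_neq0 t : I t -> derive1 T0 t != 0.
Proof. by move=> /TX1_neq0; rewrite mulf_eq0 negb_or => /andP[]. Qed.

Lemma smooth_ratio : smooth_on I y.
Proof. apply: (smooth_onM oI sX0); exact: smooth_onV X1_neq0 sX1. Qed.

Lemma smooth_pcoef k i : smooth_on I (pcoef k i).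
Proof.
have sV := smooth_onV oI derive1_T0_neq0 (smooth_on_derive1 sT0).
elim: k i => [|k IHk] [|i].
- exact: sX1.
- exact: (smooth_on_cst oI (a := 0)).
- exact: (smooth_onM oI (smooth_onD oI (smooth_on_derive1 (IHk 0%N))
    (smooth_on_cst oI (a := 0))) sV).
- exact: (smooth_onM oI (smooth_onD oI (smooth_on_derive1 (IHk i.+1)) (IHk i)) sV).
Qed.

Lemma pcoef_gt k i : (k < i)%N -> pcoef k i = fun=> 0.
Proof.
elim: k i => [|k IHk] [|i] //= ki; rewrite !IHk//; last exact: ltnW.
by apply/funext => t; rewrite derive1_cst addr0 mul0r.
Qed.

Lemma pcoef_diag k t : pcoef k k t = X1 t * (derive1 T0 t)^-1 ^+ k.
Proof.
elim: k => [|k IHk]; first by rewrite mulr1.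
by rewrite /= pcoef_gt// derive1_cst add0r IHk -mulrA -exprSr.
Qed.

Lemma pcoef_diag_neq0 k t : I t -> pcoef k k t != 0.
Proof.
move=> It; rewrite pcoef_diag mulf_neq0 ?X1_neq0//.
by rewrite expf_neq0// invr_eq0 derive1_T0_neq0.
Qed.

Lemma near_V_t t x : V (t, x) -> \forall s \near t, V (s, x).
Proof.
move=> Vtx; have [r r0 rV] := open_box oV Vtx.
apply: filterS (nbhsx_ballx t r r0) => s sr; apply: rV.
  by move: sr; rewrite /ball/= distrC.
by rewrite subrr normr0.
Qed.

Lemma near_V_x t x : V (t, x) -> \forall s \near x, V (t, s).
Proof.
move=> Vtx; have [r r0 rV] := open_box oV Vtx.
apply: filterS (nbhsx_ballx x r r0) => s sr; apply: rV.
  by rewrite subrr normr0.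
by move: sr; rewrite /ball/= distrC.
Qed.

Lemma total_derivative_affine t j : V (t, j 0%N) ->
  total_derivative 0 (on_jets T) t j = derive1 T0 t.
Proof.
move=> Vtj; rewrite total_derivative_DT /DT /partial_t /partial_x.
rewrite (@derive1_near _ _ T0); last first.
  by apply: filterS (near_V_t Vtj) => s /TXE[].
rewrite (@derive1_near _ (T t) (fun=> T0 t)) ?derive1_cst ?mulr0 ?addr0//.
by apply: filterS (near_V_x Vtj) => s /TXE[].
Qed.

(** As X = X1 (x + y) and D_t T = T_t, applying D_t and dividing by T_t takes a combination of the
    (x + y)^(i) to the next one by the recursion of [pcoef]. *)
Lemma prolongation_affine k t j : V (t, j 0%N) ->
  prolongation T X k t j =
  \sum_(i < k.+1) pcoef k i t * (j i + derive1n i y t).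
Proof.
elim: k t j => [|k IHk] t j Vtj.
  rewrite big_ord1/= /on_jets (TXE Vtj).2 /y mulrDr; congr (_ + _).
  by rewrite mulrCA divff ?mulr1// X1_neq0//; exact: (VI Vtj).
have It : I t := VI Vtj.
rewrite [LHS]/= total_derivative_affine// /total_derivative.
have dyk i : is_deriv1 (derive1n i y) t (derive1n i.+1 y t).
  exact: (derivable_is_deriv1 (@smooth_ratio i t It)).
have dck i : is_deriv1 (pcoef k i) t (derive1 (pcoef k i) t).
  exact: (smooth_on_der (@smooth_pcoef k i) It).
have -> : derive1 ((prolongation T X k)^~ j) t = \sum_(i < k.+1)
    (derive1 (pcoef k i) t * (j i + derive1n i y t) + pcoef k i t * derive1n i.+1 y t).
  rewrite (@derive1_near _ _ (fun s => \sum_(i < k.+1) pcoef k i s * (j i + derive1n i y s))).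
    apply: derive1_val; apply: is_deriv1_sum => i; apply: is_deriv1M => //.
    by have := is_deriv1D (is_deriv1_cst (j i) t) (dyk i); rewrite add0r.
  by apply: filterS (near_V_t Vtj) => s; exact: IHk.
have -> : \sum_(l < k.+1) j l.+1 * derive1 (fun s => prolongation T X k t
    [eta j with (l : nat) |-> s]) (j l) = \sum_(l < k.+1) j l.+1 * pcoef k l t.
  apply: eq_bigr => l _; congr (_ * _).
  rewrite (@derive1_near _ _ (fun s => \sum_(i < k.+1)
      pcoef k i t * (upd j l s i + derive1n i y t))); last first.
    have : \forall s \near j l, V (t, upd j l s 0%N).
      rewrite /upd; case: eqP => [<-|_]; first exact: near_V_x.
      by near=> s.
    by apply: filterS => s; exact: IHk.
  rewrite (derive1_val (l := \sum_(i < k.+1) pcoef k i t * (i == l)%:R)).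
    rewrite (bigD1 l)//= eqxx mulr1 big1 ?addr0// => i /negPf il.
    by rewrite il mulr0.
  apply: is_deriv1_sum => i; rewrite -[X in is_deriv1 _ _ X]add0r.
  rewrite -[X in is_deriv1 _ _ (X + _)](mul0r (upd j l (j l) i + derive1n i y t)).
  apply: is_deriv1M; first exact: is_deriv1_cst.
  rewrite -[_%:R]addr0; apply: is_deriv1D; last exact: is_deriv1_cst.
  rewrite /upd -val_eqE/=; case: eqP => _; [exact: is_deriv1_id|exact: is_deriv1_cst].
pose w i := j i + derive1n i y t.
transitivity ((\sum_(i < k.+1) derive1 (pcoef k i) t * w i +
    \sum_(i < k.+1) pcoef k i t * w i.+1) * (derive1 T0 t)^-1).
  congr (_ * _); rewrite -!big_split/=; apply: eq_bigr => i _.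
  by rewrite /w derive1nS; ring.
have -> : \sum_(i < k.+2) pcoef k.+1 i t * (j i + derive1n i y t) =
    (\sum_(i < k.+2) derive1 (pcoef k i) t * w i +
     \sum_(i < k.+2) (if (i : nat) is l.+1 then pcoef k l t else 0) * w i) * (derive1 T0 t)^-1.
  rewrite -big_split mulr_suml; apply: eq_bigr => i _ /=.
  by rewrite -mulrDl mulrAC.
(* Index shift: the last summand of the first sum and the first summand of the second one are
   zero. *)
congr (_ * _); rewrite [in RHS]big_ord_recr/= pcoef_gt// derive1_cst mul0r addr0.
by rewrite [X in _ = _ + X]big_ord_recl/= mul0r add0r.
Unshelve. all: by end_near.
Qed.

Section TransformedEquation.
Variables (r : nat) (a b : 'I_r -> F -> F).

(** Coefficient of (x + y)^(i) in the target equation pulled back to the original jets. *)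
Definition transformed_coef i t : F :=
  pcoef r i t + \sum_(k < r) b k (T0 t) * pcoef k i t.

Lemma transformed_coef_top t : transformed_coef r t = pcoef r r t.
Proof. by rewrite /transformed_coef big1 ?addr0// => k _; rewrite pcoef_gt ?mulr0. Qed.

Lemma transformed_lhs t j : V (t, j 0%N) ->
  linear_ode_lhs b (T t (j 0%N)) (fun k => prolongation T X k t j) =
  \sum_(i < r.+1) transformed_coef i t * (j i + derive1n i y t).
Proof.
move=> Vtj; have [TE _] := TXE Vtj.
have widen k : (k <= r)%N -> prolongation T X k t j =
    \sum_(i < r.+1) pcoef k i t * (j i + derive1n i y t).
  move=> kr; rewrite prolongation_affine// (big_ord_widen r.+1
    (fun i => pcoef k i t * (j i + derive1n i y t)))// big_mkcond/=.
  apply: eq_bigr => i _; rewrite ltnS; case: leqP => // ki.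
  by rewrite pcoef_gt// mul0r.
rewrite /linear_ode_lhs widen// TE /transformed_coef.
under [RHS]eq_bigr do rewrite mulrDl mulr_suml.
rewrite big_split/= exchange_big/=; congr (_ + _); apply: eq_bigr => k _.
rewrite widen 1?ltnW// mulr_sumr; apply: eq_bigr => i _; exact: mulrA.
Qed.

(** Eliminating x^(r) by the original equation makes the pulled-back equation an affine identity in
    x, ..., x^(r-1) on an open set. Its linear part gives g_i = g_r a_i; its constant part is then
    g_r times the left-hand side of the original equation at y. *)
Lemma ratio_solution t x : (0 < r)%N -> maps_ode V T X a b -> V (t, x) ->
  linear_ode_lhs a t (fun k => derive1n k y t) = 0.
Proof.
move=> r0 mapsV Vtx; have It : I t := VI Vtx.
pose g i := transformed_coef i t; pose C := \sum_(i < r.+1) g i * derive1n i y t.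
pose d (i : 'I_r) := g i - g r * a i t.
have top0 : g r != 0 by rewrite /g transformed_coef_top pcoef_diag_neq0.
have E j : V (t, j 0%N) -> \sum_(i < r) d i * j i + C = 0.
  move=> Vtj; pose j' := upd j r (- \sum_(k < r) a k t * j k).
  have jj' k : (k < r)%N -> j' k = j k by move=> kr; rewrite /j' upd_neq// ltn_eqF.
  have j'r : j' r = - \sum_(k < r) a k t * j k by rewrite /j' upd_eq.
  have Vtj' : V (t, j' 0%N) by rewrite jj'.
  have : linear_ode_lhs a t j' = 0.
    rewrite /linear_ode_lhs j'r addrC -sumrN -big_split big1//= => k _.
    by rewrite jj'// subrr.
  rewrite mapsV//; last by rewrite total_derivative_affine// derive1_T0_neq0.
  rewrite transformed_lhs// => E; rewrite -[RHS]E.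
  under [RHS]eq_bigr do rewrite mulrDr.
  rewrite big_split/=; congr (_ + _); rewrite big_ord_recr/= j'r mulrN mulr_sumr.
  rewrite -sumrN -big_split; apply: eq_bigr => i _ /=.
  by rewrite jj'// /d /g; ring.
have d0 i : d i = 0.
  have [e e0 eV] := open_box oV Vtx.
  pose j (k : nat) := if k is 0%N then x else 0.
  have E1 := E j Vtx.
  (* Moving one coordinate by e / 2 isolates [d i]; for i = 0 the point stays in the box inside
     [V]. *)
  have /E : V (t, upd j i (j i + e / 2) 0%N).
    apply: eV; first by rewrite subrr normr0.
    rewrite /upd; case: eqP => [<-|_] /=; last by rewrite subrr normr0.
    rewrite addrAC subrr add0r ger0_norm ?divr_ge0 ?(ltW e0)//.
    by rewrite ltr_pdivrMr// ltr_pMr// ltr1n.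
  rewrite -[RHS]E1 => /addIr; rewrite (bigD1 i)//= [in RHS](bigD1 i)//= upd_eq.
  rewrite (eq_bigr (fun k : 'I_r => d k * j k)); last first.
    by move=> k ki; rewrite upd_neq.
  move=> /addIr/eqP; rewrite mulrDr -subr_eq0 addrAC subrr add0r mulf_eq0.
  by rewrite mulf_eq0 invr_eq0 pnatr_eq0 (gt_eqF e0) !orbF => /eqP.
have C0 : C = 0.
  rewrite -(E (fun=> x) Vtx) big1 ?add0r// => i _.
  by rewrite d0 mul0r.
apply: (mulfI top0); rewrite mulr0 -C0 /C big_ord_recr/= addrC /linear_ode_lhs mulrDr.
congr (_ + _); rewrite mulr_sumr; apply: eq_bigr => i _.
by rewrite mulrA; congr (_ * _); apply/esym/eqP; rewrite -subr_eq0; apply/eqP; exact: d0.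
Qed.

End TransformedEquation.

(** A triangular system with nonzero diagonal, solved from the highest index down; the only
    divisions are by diagonal entries, so smoothness is kept. *)
Lemma exists_inverse_coef n (m : nat -> F -> F) : (forall i, smooth_on I (m i)) ->
  exists be : nat -> F -> F, (forall k, smooth_on I (be k)) /\
    forall t i, I t -> (i < n)%N -> \sum_(k < n) be k t * pcoef k i t = m i t.
Proof.
elim: n m => [|n IHn] m sm.
  by exists m; split.
pose c t := m n t / pcoef n n t.
have c0 t : I t -> pcoef n n t != 0 by exact: pcoef_diag_neq0.
have sc : smooth_on I c.
  exact: (smooth_onM oI (sm n) (smooth_onV oI c0 (@smooth_pcoef n n))).
(* The top unknown is [c]; its contribution is moved to the right-hand side of the remaining
   equations. *)
have [|be [sbe beE]] := IHn (fun i t => m i t + - (c t * pcoef n i t)).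
  move=> i; apply: (smooth_onD oI (sm i)); apply: (smooth_onN oI).
  exact: (smooth_onM oI sc (@smooth_pcoef n i)).
exists (fun k => if k == n then c else be k); split.
  by move=> k; case: eqP => _; [exact: sc|exact: sbe].
move=> t i It; rewrite ltnS leq_eqVlt big_ord_recr/= eqxx => /orP[/eqP ->|i_n].
  rewrite big1 ?add0r; last by move=> k _; rewrite pcoef_gt ?mulr0.
  by rewrite divfK// c0.
under eq_bigr => k _ do rewrite ltn_eqF//.
by rewrite beE// subrK.
Qed.

End AffineTransformation.

(** * Restriction to smaller domains, slices and boxes *)

Lemma Cn_onS (F : numFieldType) n (U V : set (F * F)) f :
  V `<=` U -> Cn_on n U f -> Cn_on n V f.
Proof.
move=> VU; elim: n f => [|n IHn] f /= [cf].
  by move=> _; split=> // p /VU; exact: cf.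
move=> [dt dx Ct Cx]; split; first by move=> p /VU; exact: cf.
by split; [move=> p /VU; exact: dt|move=> p /VU; exact: dx|exact: IHn|exact: IHn].
Qed.

Lemma smooth2_onS (F : numFieldType) (U V : set (F * F)) f :
  V `<=` U -> smooth2_on U f -> smooth2_on V f.
Proof. by move=> VU sf n; exact: Cn_onS (sf n). Qed.

Lemma maps_odeS (F : numFieldType) r (U V : set (F * F)) T X (a b : 'I_r -> F -> F) :
  V `<=` U -> maps_ode U T X a b -> maps_ode V T X a b.
Proof. by move=> VU mapsU t j /VU; exact: mapsU. Qed.

Lemma smooth2_on_slice (F : numFieldType) (U : set (F * F)) (I : set F) x0 f :
  (forall t, I t -> U (t, x0)) -> smooth2_on U f -> smooth_on I (f ^~ x0).
Proof.
move=> IU sf; apply/smooth_onP => n; elim: n f sf => // n IHn f sf.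
split; first by move=> t /IU Utx; exact: (smooth2_on_is_deriv_t sf Utx).1.
by apply: (IHn (partial_t f)); exact: smooth2_on_t.
Qed.

Lemma open_box_set (F : numFieldType) (A B : set F) : open A -> open B ->
  open [set p : F * F | A p.1 /\ B p.2].
Proof.
rewrite !openE => oA oB p [/oA/= nA /oB/= nB].
by exists (A, B).
Qed.

(** * The two implications *)

Section MainTheorem.
Variable F : numFieldType.
Hypothesis FC : geometrically_complete F.
Variables (r : nat) (I : set F) (a : 'I_r -> F -> F) (T X : F -> F -> F).
Hypotheses (r3 : (2 < r)%N) (oI : open I) (sa : forall k, smooth_on I (a k)).

Lemma maps_ode_affine (V : set (F * F)) (b : 'I_r -> F -> F) (p0 : F * F) :
  open V -> smooth2_on V T -> smooth2_on V X ->
  (forall p, V p -> partial_t T p.1 p.2 * partial_x X p.1 p.2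
      - partial_x T p.1 p.2 * partial_t X p.1 p.2 != 0) ->
  (forall p, V p -> I p.1) -> V p0 -> maps_ode V T X a b ->
  exists (V' : set (F * F)) (I' : set F) (T0 X1 X0 : F -> F),
     [/\ open V', V' p0 & V' `<=` V] /\
     [/\ open I', I' `<=` I & forall p, V' p -> I' p.1] /\
     [/\ smooth_on I' T0, smooth_on I' X1 & smooth_on I' X0] /\
     [/\ forall t, I' t -> derive1 T0 t * X1 t != 0,
         forall t x, V' (t, x) -> T t x = T0 t /\ X t x = X1 t * x + X0 t
       & solution_on I' a (fun t => X0 t / X1 t)].
Proof.
case: p0 => t0 x0 oV sT sX J0 VI V0 mapsV.
have [n rn n2] : exists2 n, r = n.+1 & (1 < n)%N by case: (r) r3 => // n; exists n.
have jac0 p : V p -> ev T (jac T X) p.1 (fun=> p.2) != 0.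
  by move=> /J0; rewrite ev_jac.
have Tx0 p : V p -> partial_x T p.1 p.2 = 0.
  move=> Vp; move: a b mapsV; rewrite rn => a' b' mapsV.
  exact: (partial_x_T_eq0 oV sT sX n2 mapsV (jac0 _ Vp) Vp).
have [e e0 eV] := open_box oV V0.
(* A box around the base point: its slices in x are balls, to which the mean value inequality
   applies. *)
pose I' := [set t | `|t - t0| < e]; pose K := [set x | `|x - x0| < e].
pose V' := [set p : F * F | I' p.1 /\ K p.2].
have oI' : open I' by exact: open_dist_lt.
have oK : open K by exact: open_dist_lt.
have oV' : open V' by exact: open_box_set.
have V'V : V' `<=` V by move=> [t x] [/= It Kx]; exact: eV.
have Kx0 : K x0 by rewrite /K/= subrr normr0.
have It0 : I' t0 by rewrite /I'/= subrr normr0.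
have I'V t : I' t -> V (t, x0) by move=> It; apply: V'V.
have sT' := smooth2_onS V'V sT; have sX' := smooth2_onS V'V sX.
have TE t x : V' (t, x) -> T t x = T t x0.
  move=> [/= It Kx]; apply: (@derive1_eq0_cst _ FC (T t) _ _ _ _ Kx) => z Kz.
  have Vtz : V' (t, z) by [].
  by rewrite -(Tx0 (t, z) (V'V _ Vtz)); exact: (smooth2_on_is_deriv_x sT' Vtz).
(* Obtained from T(t, x) = T(t, x0) on the box, instead of exchanging mixed derivatives. *)
have Ttx0 p : V' p -> partial_x (partial_t T) p.1 p.2 = 0.
  case: p => t x [/= It Kx]; rewrite {1}/partial_x.
  rewrite (@derive1_near _ _ (fun=> partial_t T t x0)) ?derive1_cst//.
  apply: filterS (open_nbhs_nbhs (conj oK Kx)) => z Kz; apply: derive1_near.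
  by apply: filterS (open_nbhs_nbhs (conj oI' It)) => s Is; exact: TE.
have Tx0' p : V' p -> partial_x T p.1 p.2 = 0 by move=> /V'V/Tx0.
have Xxx0 p : V' p -> partial_x (partial_x X) p.1 p.2 = 0.
  move=> Vp; move: a b mapsV; rewrite rn => a' b' /(maps_odeS V'V) mapsV.
  exact: (partial_xx_X_eq0 oV' sT' sX' n2 mapsV Tx0' Ttx0 (jac0 _ (V'V _ Vp)) Vp).
(* Taylor coefficients in x at x0; X_xx = 0 will make the expansion of X exact. *)
pose T0 := T ^~ x0; pose X1 := (partial_x X) ^~ x0.
pose X0 t := X t x0 + - (X1 t * x0).
have XxE t x : V' (t, x) -> partial_x X t x = X1 t.
  move=> [/= It Kx]; apply: (@derive1_eq0_cst _ FC (partial_x X t) _ _ _ _ Kx) => z Kz.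
  have Vtz : V' (t, z) by [].
  by rewrite -(Xxx0 _ Vtz); exact: (smooth2_on_is_deriv_x (smooth2_on_x sX') Vtz).
have XE t x : V' (t, x) -> X t x = X1 t * x + X0 t.
  move=> [/= It Kx].
  have : X t x + - X1 t * x = X t x0 + - X1 t * x0.
    apply: (@derive1_eq0_cst _ FC (fun s => X t s + - X1 t * s) _ _ _ _ Kx) => z Kz.
    have Vtz : V' (t, z) by [].
    have := is_deriv1D (smooth2_on_is_deriv_x sX' Vtz)
      (is_deriv1M (is_deriv1_cst (- X1 t) z) (is_deriv1_id z)).
    by rewrite mul0r add0r mulr1 (XxE _ _ Vtz) subrr.
  by rewrite /X0 !mulNr => <-; ring.
have sT0 : smooth_on I' T0 by apply: smooth2_on_slice sT'.
have sX1 : smooth_on I' X1.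
  by apply: smooth2_on_slice (smooth2_on_x sX').
have sX0 : smooth_on I' X0.
  apply: (smooth_onD oI'); first by apply: smooth2_on_slice sX'.
  apply: (smooth_onN oI'); exact: (smooth_onM oI' sX1 (smooth_on_cst oI' (a := x0))).
have TX t : I' t -> derive1 T0 t * X1 t != 0.
  by move=> /I'V Vt; have := J0 _ Vt; rewrite (Tx0 _ Vt) mul0r subr0.
have TXE t x : V' (t, x) -> T t x = T0 t /\ X t x = X1 t * x + X0 t.
  by move=> Vtx; split; [exact: TE|exact: XE].
have V'I p : V' p -> I' p.1 by case.
exists V', I', T0, X1, X0; do ![split=> //].
- by move=> t /I'V/VI.
- move=> k t _ It; exact: (@smooth_ratio _ _ _ _ _ oI' sX1 sX0 TX k t It).
- move=> t It; apply: (@ratio_solution _ _ _ _ _ _ _ _ oV' oI' V'I sT0 sX1 sX0 TX TXE _ _ b t x0).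
  + exact: leq_trans r3.
  + exact: maps_odeS mapsV.
  + by [].
Qed.

Lemma affine_maps_ode (V : set (F * F)) (I' : set F) (T0 X1 X0 : F -> F) (p0 : F * F) :
  open V -> V p0 -> open I' -> I' `<=` I -> (forall p, V p -> I' p.1) ->
  smooth_on I' T0 -> smooth_on I' X1 -> smooth_on I' X0 ->
  (forall t, I' t -> derive1 T0 t * X1 t != 0) ->
  (forall t x, V (t, x) -> T t x = T0 t /\ X t x = X1 t * x + X0 t) ->
  solution_on I' a (fun t => X0 t / X1 t) ->
  exists (V' : set (F * F)) (J : set F) (b : 'I_r -> F -> F),
     [/\ open V', V' p0 & V' `<=` V] /\
     [/\ in_linear_class J b,
         forall p, V' p -> J (T p.1 p.2)
       & maps_ode V' T X a b].
Proof.
case: p0 => t0 x0 oV V0 oI' I'I VI sT0 sX1 sX0 TX TXE [_ sol].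
have It0 : I' t0 := VI _ V0.
have [rho [sigma [S [rho0 sigma0 SI SK sS]]]] :=
  local_inverse FC oI' sT0 It0 (derive1_T0_neq0 TX It0).
pose J := [set y | `|y - T0 t0| < sigma].
(* The points where [S] inverts [T0] and [T0] takes values in the domain of the new coefficients. *)
pose W := [set t | I' t /\ (`|t - t0| < rho /\ J (T0 t))].
have oJ : open J by exact: open_dist_lt.
have oW : open W.
  rewrite openE => t [It [tr Jt]] /=.
  have cT : {for t, continuous T0}.
    exact: (derivable_continuous (smooth_on_der sT0 It).1).
  have nJ : \forall s \near t, J (T0 s) by exact: (cT _ (open_nbhs_nbhs (conj oJ Jt))).
  have nr := open_nbhs_nbhs (conj (@open_dist_lt F t0 rho) tr).
  have nI := open_nbhs_nbhs (conj oI' It).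
  by apply: filterS3 nI nr nJ.
have W0 : W t0 by split=> //; split; rewrite /J/= subrr normr0.
pose V' := [set p | V p /\ W p.1].
have oV' : open V'.
  have -> : V' = V `&` [set p | W p.1 /\ setT p.2].
    by apply/seteqP; split=> [p [Vp Wp]|p [Vp [Wp _]]].
  by apply: openI => //; apply: open_box_set => //; exact: openT.
have V'V : V' `<=` V by move=> p [].
(* With these right-hand sides the transformed coefficients become [pcoef r r] times the original
   ones; the default 0 stands for indices i >= r. *)
pose m i t := pcoef T0 X1 r r t * oapp (fun k : 'I_r => a k t) 0 (insub i)
  + - pcoef T0 X1 r i t.
have sp k i : smooth_on I' (pcoef T0 X1 k i) by apply: smooth_pcoef.
have sm i : smooth_on I' (m i).
  apply: (smooth_onD oI' _ (smooth_onN oI' (sp r i))).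
  apply: (smooth_onM oI' (sp r r)); case: insub => [k|] /=.
    exact: (smooth_onS I'I (@sa k)).
  exact: (smooth_on_cst oI' (a := 0)).
have [be [sbe beE]] := exists_inverse_coef oI' sT0 sX1 TX r sm.
(* The local inverse turns functions of t into functions of the new independent variable. *)
pose b (k : 'I_r) y := be k (S y).
exists V', J, b; split; first by split.
split; first by split=> // k; exact: (smooth_on_comp oJ SI (sbe k) sS).
  by move=> [t x] [Vtx [_ [_ Jt]]] /=; rewrite (TXE _ _ Vtx).1.
move=> t j V't _; have [Vtj [It [tr Jt]]] := V't.
rewrite (transformed_lhs oV oI' VI sT0 sX1 sX0 TX TXE)//.
have coefE i : (i < r)%N ->
    transformed_coef T0 X1 b i t = pcoef T0 X1 r r t * oapp (fun k : 'I_r => a k t) 0 (insub i).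
  move=> ir; rewrite /transformed_coef /b SK// beE// /m; exact: subrKC.
have -> : \sum_(i < r.+1) transformed_coef T0 X1 b i t *
    (j i + derive1n i (fun t => X0 t / X1 t) t) =
    pcoef T0 X1 r r t * linear_ode_lhs a t j.
  (* Linearity splits the equation at x + y, and the part at y vanishes. *)
  transitivity (pcoef T0 X1 r r t * (linear_ode_lhs a t j +
      linear_ode_lhs a t (fun k => derive1n k (fun t => X0 t / X1 t) t))).
    rewrite big_ord_recr/= transformed_coef_top addrC /linear_ode_lhs.
    rewrite addrACA -big_split/= [in RHS]mulrDr; congr (_ + _).
    rewrite mulr_sumr; apply: eq_bigr => i _.
    by rewrite coefE// valK/= -mulrDr mulrA.
  by rewrite sol// addr0.
split=> [->|/eqP]; first by rewrite mulr0.
by rewrite mulf_eq0 (negPf (pcoef_diag_neq0 TX r It))/= => /eqP.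
Qed.

End MainTheorem.

Lemma geometrically_complete_R_or_C (R : realType) (F : numFieldType) :
  F = (R : numFieldType) \/ F = (R[i] : numFieldType) -> geometrically_complete F.
Proof.
by case=> ->; [exact: geometrically_complete_real|exact: geometrically_complete_complex].
Qed.

Theorem corollary7 (R : realType) (F : numFieldType)
  (hF : F = (R : numFieldType) \/ F = (R[i] : numFieldType))
  (r : nat) (hr : (3 <= r)%N)
  (I : set F) (a : 'I_r -> F -> F) (hE : in_linear_class I a)
  (U : set (F * F)) (T X : F -> F -> F) (hTX : point_transformation U T X)
  (hUI : forall p, U p -> I p.1)
  (p0 : F * F) (hp0 : U p0) :
  (exists (V : set (F * F)) (J : set F) (b : 'I_r -> F -> F),
     [/\ open V, V p0 & V `<=` U] /\
     [/\ in_linear_class J b,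
         forall p, V p -> J (T p.1 p.2)
       & maps_ode V T X a b])
  <->
  (exists (V : set (F * F)) (I' : set F) (T0 X1 X0 : F -> F),
     [/\ open V, V p0 & V `<=` U] /\
     [/\ open I', I' `<=` I & forall p, V p -> I' p.1] /\
     [/\ smooth_on I' T0, smooth_on I' X1 & smooth_on I' X0] /\
     [/\ forall t, I' t -> derive1 T0 t * X1 t != 0,
         forall t x, V (t, x) -> T t x = T0 t /\ X t x = X1 t * x + X0 t
       & solution_on I' a (fun t => X0 t / X1 t)]).
Proof.
have FC := geometrically_complete_R_or_C hF.
have [oU sT sX J0] := hTX; have [oI sa] := hE; split.
- move=> [V [J [b [[oV V0 VU] [_ _ mapsV]]]]].
  have [||V' [I' [T0 [X1 [X0 [[oV' V'0 V'V] h]]]]]] :=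
    maps_ode_affine (I := I) FC hr oV (smooth2_onS VU sT) (smooth2_onS VU sX) _ _ V0 mapsV.
  + by move=> p /VU; exact: J0.
  + by move=> p /VU; exact: hUI.
  by exists V', I', T0, X1, X0; split=> //; split=> // p /V'V/VU.
- move=> [V [I' [T0 [X1 [X0 [[oV V0 VU] [[oI' I'I VI] [[sT0 sX1 sX0] [TX TXE sol]]]]]]]]].
  have [V' [J [b [[oV' V'0 V'V] h]]]] :=
    affine_maps_ode FC sa oV V0 oI' I'I VI sT0 sX1 sX0 TX TXE sol.
  by exists V', J, b; split=> //; split=> // p /V'V/VU.
Qed.
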